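(* Let $R$ be a quasi-finite ring with $1$, let $n\ge 3$, and let $A,B$ be two-sided ideals of $R$. Then $$[E(n,A),\operatorname{GL}(n,R,B)]=[E(n,A),E(n,B)].$$
   Context: All rings are associative with $1$. A ring is module finite if it is finitely generated as a module over its centre; a ring is quasi-finite if it is a direct limit of module finite rings (equivalently, a directed union of unital subrings each of which is finitely generated as a module over its own centre). $\operatorname{GL}(n,R)$ is the general linear group of degree $n$ over $R$; $e$ is the identity matrix and $e_{ij}$ the standard matrix units. For $c\in R$ and $1\le i\ne j\le n$, $t_{ij}(c)=e+ce_{ij}$ is the elementary transvection. For a two-sided ideal $A$ of $R$, $E(n,A)=\langle t_{ij}(a) : a\in A,\ 1\le i\ne j\le n\rangle$. For a two-sided ideal $I$ of $R$, the principal congruence subgroup $\operatorname{GL}(n,R,I)$ is the kernel of the reduction homomorphism $\operatorname{GL}(n,R)\to\operatorname{GL}(n,R/I)$. Commutators are $[x,y]=xyx^{-1}y^{-1}$; for subgroups $H,K$ of a group, $[H,K]$ is the subgroup generated by all $[h,k]$, $h\in H$, $k\in K$. *)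

(* Defs.v *)
From HB Require Import structures.
From mathcomp Require Import all_boot all_algebra.
From mathcomp Require Import boolp classical_sets.

Set Implicit Arguments.
Unset Strict Implicit.
Unset Printing Implicit Defensive.

Import GRing.Theory.

Local Open Scope classical_set_scope.
Local Open Scope ring_scope.

(* Rings are [pzRingType]s: associative with 1, not assumed commutative, and
   the zero ring is allowed. *)

Section Rings.
Variable R : pzRingType.
Implicit Types (S I : set R).

Definition two_sided_ideal I : Prop :=
  [/\ I 0,
      forall x y, I x -> I y -> I (x - y)
    & forall r x, I x -> I (r * x) /\ I (x * r)].

Definition centre S : set R :=
  [set c | S c /\ forall s, S s -> c * s = s * c].

(* For a subring [S] of [R]. *)
Definition module_finite S : Prop :=
  exists (k : nat) (x : 'I_k -> R),
    (forall i, S (x i)) /\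
    forall s, S s -> exists c : 'I_k -> R,
      (forall i, centre S (c i)) /\ s = \sum_(i < k) c i * x i.

(* [GRing.subring_closed] includes the 1 of [R]. Nonemptiness of the directed
   family [F] follows from its union being all of [R]. *)
Definition quasi_finite : Prop :=
  exists F : set (set R),
    [/\ forall S, F S -> GRing.subring_closed (mem S) /\ module_finite S,
        forall S T, F S -> F T -> exists U, [/\ F U, S `<=` U & T `<=` U]
      & \bigcup_(S in F) S = setT].

(* The image of [r] in [R / I], whose elements are the additive cosets of I. *)
Definition coset I (r : R) : set R := [set s | I (s - r)].

End Rings.

(* [unitmx] is only available over commutative rings, so an element of GL(n, R)
   is represented by an invertible matrix paired with its two-sided inverse;
   by [GL_mx_inj] the matrix determines the element. *)
Section GeneralLinear.
Variables (n : nat) (R : pzRingType).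
Local Open Scope group_scope.

Definition inverse_pair : pred ('M[R]_n * 'M[R]_n) :=
  fun p => (p.1 *m p.2 == 1%:M)%R && (p.2 *m p.1 == 1%:M)%R.

Record GL := MkGL { GL_pair :> 'M[R]_n * 'M[R]_n; GL_pairP : inverse_pair GL_pair }.

HB.instance Definition _ := [isSub for GL_pair].
HB.instance Definition _ := [Choice of GL by <:].

Definition GL_mx (g : GL) : 'M[R]_n := g.1.

Lemma GL_mulV (g : GL) : g.1 *m g.2 = 1%:M.
Proof. by case/andP: (GL_pairP g) => /eqP. Qed.

Lemma GL_Vmul (g : GL) : g.2 *m g.1 = 1%:M.
Proof. by case/andP: (GL_pairP g) => _ /eqP. Qed.

Lemma GL_mx_inj : injective GL_mx.
Proof.
move=> g h; rewrite /GL_mx => gh; apply: val_inj.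
rewrite /= [GL_pair g]surjective_pairing [GL_pair h]surjective_pairing gh.
congr pair.
by rewrite -[g.2]mulmx1 -(GL_mulV h) -gh mulmxA GL_Vmul mul1mx.
Qed.

Lemma GL_one_subproof : inverse_pair (1%:M, 1%:M).
Proof. by rewrite /inverse_pair /= mulmx1 eqxx. Qed.

Lemma GL_mul_subproof (g h : GL) : inverse_pair (g.1 *m h.1, h.2 *m g.2).
Proof.
rewrite /inverse_pair /= -mulmxA [h.1 *m _]mulmxA GL_mulV mul1mx GL_mulV eqxx.
by rewrite -mulmxA [g.2 *m _]mulmxA GL_Vmul mul1mx GL_Vmul eqxx.
Qed.

Lemma GL_inv_subproof (g : GL) : inverse_pair (g.2, g.1).
Proof. by rewrite /inverse_pair /= GL_mulV GL_Vmul eqxx. Qed.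

Definition GL_one := MkGL GL_one_subproof.
Definition GL_mul (g h : GL) := MkGL (GL_mul_subproof g h).
Definition GL_inv (g : GL) := MkGL (GL_inv_subproof g).

Lemma GL_mulA : associative GL_mul.
Proof. by move=> g h k; apply: GL_mx_inj; rewrite /GL_mx /= mulmxA. Qed.

Lemma GL_mul1 : left_id GL_one GL_mul.
Proof. by move=> g; apply: GL_mx_inj; rewrite /GL_mx /= mul1mx. Qed.

Lemma GL_mulr1 : right_id GL_one GL_mul.
Proof. by move=> g; apply: GL_mx_inj; rewrite /GL_mx /= mulmx1. Qed.

Lemma GL_mulVg : left_inverse GL_one GL_inv GL_mul.
Proof. by move=> g; apply: GL_mx_inj; rewrite /GL_mx /= GL_Vmul. Qed.

Lemma GL_mulgV : right_inverse GL_one GL_inv GL_mul.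
Proof. by move=> g; apply: GL_mx_inj; rewrite /GL_mx /= GL_mulV. Qed.

HB.instance Definition _ :=
  isGroup.Build GL GL_mulA GL_mul1 GL_mulr1 GL_mulVg GL_mulgV.

End GeneralLinear.

Section Subgroups.
Variable G : groupType.
Local Open Scope group_scope.

Definition subgroup (H : set G) : Prop := group_closed (mem H).

Definition generated (X : set G) : set G := smallest subgroup X.

(* The convention [x, y] = x y x^-1 y^-1 differs from MathComp's [~ x, y]. *)
Definition commutator (x y : G) : G := x * y * x^-1 * y^-1.

Definition commutator_subgroup (H K : set G) : set G :=
  generated [set commutator h k | h in H & k in K].

End Subgroups.

Section Elementary.
Variables (n : nat) (R : pzRingType).

Definition transvection_mx (i j : 'I_n) (c : R) : 'M[R]_n :=
  1%:M + c *: delta_mx i j.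

Lemma transvection_subproof (i j : 'I_n) (c : R) : i != j ->
  inverse_pair (transvection_mx i j c, transvection_mx i j (- c)).
Proof.
move=> ij; have mulT (a b : R) : a + b = 0 ->
    transvection_mx i j a *m transvection_mx i j b = 1%:M.
  move=> ab0; rewrite /transvection_mx mulmxDl mul1mx mulmxDr mulmx1.
  have -> : (a *: delta_mx i j) *m (b *: delta_mx i j) = 0 :> 'M[R]_n.
    apply/matrixP => k l; rewrite !mxE big1 // => m _; rewrite !mxE.
    have [->|mj] := eqVneq m j; last by rewrite andbF mulr0 mul0r.
    by rewrite [j == i]eq_sym (negPf ij) mulr0 mulr0.
  by rewrite addr0 -addrA -scalerDl [b + a]addrC ab0 scale0r addr0.
by rewrite /inverse_pair /= !mulT ?subrr ?addNr ?eqxx.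
Qed.

Definition transvection (i j : 'I_n) (c : R) (ij : i != j) : GL n R :=
  MkGL (transvection_subproof c ij).

Definition elementary_subgroup (A : set R) : set (GL n R) :=
  generated [set g | exists (i j : 'I_n) (ij : i != j) (a : R),
                       A a /\ g = transvection a ij].

(* The kernel of entrywise reduction modulo [I]: two matrices over [R] have the
   same image over [R / I] iff their matrices of cosets are equal. *)
Definition principal_congruence_subgroup (I : set R) : set (GL n R) :=
  [set g | map_mx (coset I) (GL_mx g) = map_mx (coset I) 1%:M].

End Elementary.

Arguments elementary_subgroup n {R} A.
Arguments principal_congruence_subgroup n {R} I.

(* Main.v *)
(* Let J = AB + BA and H = [E(n,A), E(n,B)], and let K(I) be the subgroup generated by
   the e + uv with u a column over the ideal I, vu = 0 and some v_l = 1; it is normalized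
   by E(n,R), so it is the relative elementary group E(n,R,I).

   First, [GL(n,R,I), E(n,R)] lies in K(I). For g with entries in a subring S that is
   finite over its centre C, the c in C with [g, t_ij(rc)] in K(I) for all r form an
   ideal of C. If it lay in a maximal ideal m, stable rank 1 of S/mS would allow one to
   multiply g by an elementary matrix of level I so that g_ii divides some s in C \ m.
   Then g t_ij(rs) g^-1 = e + u(rs)v, where u is column i of g and v is row j of g^-1,
   and sv is a combination of rows annihilating u that have at most two nonzero entries;
   as n >= 3, the resulting factors are explicit products in E(n,R).

   Next, K(J) lies in H, since e + u(ab)v = [e + u a e_k, e + e_k b v] if u_k = v_k = 0.
   As H lies in GL(n,R,J), the first step shows that E(n,R) normalizes H; this gives
   [E(n,A), K(B)] <= H. Finally, for x = t_il(a), y = t_lj(1), t = [x,y] = t_ij(a)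
   and g in GL(n,R,B), put p = [g,x] in GL(n,R,J) and q = [g,y] in K(B). Then
   [g,t] = [p, xqyx^-1] [x,q] [q,t], and all three factors lie in H. *)

Require Import Defs.
From HB Require Import structures.
From mathcomp Require Import all_boot all_algebra.
From mathcomp Require Import boolp classical_sets.
From Stdlib Require Ncring Ncring_tac.

Set Implicit Arguments.
Unset Strict Implicit.
Unset Printing Implicit Defensive.

Import GRing.Theory.
Local Open Scope classical_set_scope.
Local Open Scope ring_scope.

(** * Identities in noncommutative rings *)

Section NcringInstance.
Variable R : pzRingType.

#[local] Instance ncring_ops : @Ncring.Ring_ops R 0 1 +%R *%R
  (fun x y => x - y) -%R eq := {}.

#[local] Instance ncring_ring : Ncring.Ring (Ro := ncring_ops).
Proof.
split=> //.
- exact: RelationClasses.eq_equivalence.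
- by move=> ? ? -> ? ? ->.
- by move=> ? ? -> ? ? ->.
- by move=> ? ? -> ? ? ->.
- by move=> ? ? ->.
- exact: add0r.
- exact: addrC.
- exact: addrA.
- exact: mul1r.
- exact: mulr1.
- exact: mulrA.
- exact: mulrDl.
- by move=> x y z; exact: mulrDr.
- exact: subrr.
Qed.

End NcringInstance.
#[local] Existing Instance ncring_ops.
#[local] Existing Instance ncring_ring.
Ltac ncring := Ncring_tac.non_commutative_ring.

(** * Stable rank one at a maximal ideal of the centre *)

Section TwoSidedIdeals.
Variables (R : pzRingType) (I : set R).
Hypothesis idI : two_sided_ideal I.

Lemma ideal_zero : I 0. Proof. by case: idI. Qed.

Lemma ideal_sub x y : I x -> I y -> I (x - y).
Proof. by case: idI => _ + _; apply. Qed.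

Lemma ideal_opp x : I x -> I (- x).
Proof. by rewrite -sub0r; apply: ideal_sub; apply: ideal_zero. Qed.

Lemma ideal_add x y : I x -> I y -> I (x + y).
Proof. by move=> Ix /ideal_opp Iy; rewrite -[y]opprK; apply: ideal_sub. Qed.

Lemma ideal_mull r x : I x -> I (r * x).
Proof. by case: idI => _ _ + Ix => /(_ r x Ix)[]. Qed.

Lemma ideal_mulr r x : I x -> I (x * r).
Proof. by case: idI => _ _ + Ix => /(_ r x Ix)[]. Qed.

Lemma ideal_sum (J : finType) (P : pred J) (F : J -> R) :
  (forall j, P j -> I (F j)) -> I (\sum_(j | P j) F j).
Proof. by move=> IF; apply: big_ind => //; [apply: ideal_zero|apply: ideal_add]. Qed.

End TwoSidedIdeals.

Section Centre.
Variable R : pzRingType.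
Local Notation Z := (centre [set: R]).

Lemma centreP c : Z c <-> forall s, c * s = s * c.
Proof. by split=> [[_ +] s|cC]; [apply|split=> // s _; apply: cC]. Qed.

Lemma centre0 : Z 0. Proof. by apply/centreP => s; rewrite mulr0 mul0r. Qed.
Lemma centre1 : Z 1. Proof. by apply/centreP => s; rewrite mulr1 mul1r. Qed.

Lemma centreB c d : Z c -> Z d -> Z (c - d).
Proof.
by move=> /centreP cC /centreP dC; apply/centreP => s; rewrite mulrBl mulrBr cC dC.
Qed.

Lemma centreM c d : Z c -> Z d -> Z (c * d).
Proof.
move=> /centreP cC /centreP dC; apply/centreP => s.
by rewrite -mulrA dC mulrA cC mulrA.
Qed.

End Centre.

(** * Quotients of finite length over the centre *)

Section FiniteLength.
Variables (R : pzRingType) (I : set R).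
Local Notation Z := (centre [set: R]).
Hypothesis idI : two_sided_ideal I.
Hypothesis fieldI : forall c, Z c -> I c \/ exists2 d, Z d & I (c * d - 1).

(** Under [fieldI] a nonzero R / I is a vector space over the image of the centre; these are the
    preimages of its subspaces. *)
Definition submodule_above (L : set R) :=
  [/\ I `<=` L, forall x y, L x -> L y -> L (x - y)
    & forall c x, Z c -> L x -> L (c * x)].

(** Codimension is bounded through a spanning family of R / L, which avoids bases. *)
Definition codim_le k (L : set R) := exists x : 'I_k -> R,
  forall s, exists2 c : 'I_k -> R, forall i, Z (c i) & L (s - \sum_i c i * x i).

Lemma submoduleD L x y : submodule_above L -> L x -> L y -> L (x + y).
Proof.
case=> IL LB _ Lx Ly; rewrite -[y]opprK; apply: (LB) => //.
by rewrite -sub0r; apply: LB => //; apply: IL; apply: ideal_zero.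
Qed.

(* A vector of L' outside L lets one exchange a generator of R / L. *)
Lemma codim_drop k (L L' : set R) z : submodule_above L -> submodule_above L' ->
  L `<=` L' -> L' z -> ~ L z -> codim_le k L ->
  exists2 k', k = k'.+1 & codim_le k' L'.
Proof.
move=> sL sL' LL' L'z nLz [x xP].
have [c cZ Lc] := xP z.
have [Ic|/existsNP[i nIci]] := pselect (forall i, I (c i)).
  case: nLz; rewrite -(subrK (\sum_i c i * x i) z); apply: submoduleD => //.
  by case: sL => IL _ _; apply: IL; apply: ideal_sum => // i _; apply: ideal_mulr.
have [//|[d Zd Id]] := fieldI (cZ i).
case: k => [|k] in x xP c cZ Lc i nIci Id *; first by case: i {nIci Id}.
(* As sum_j c_j x_j lies in L', the generator x_i equals - d sum_{j != i} c_j x_j modulo L' and can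
   be eliminated. *)
exists k => //; exists (x \o lift i) => s.
have [c' c'Z Lc'] := xP s.
exists (fun j => c' (lift i j) - c' i * d * c (lift i j)).
  by move=> j; apply: centreB => //; apply: centreM => //; apply: centreM.
have [IL' LB' LZ'] := sL'.
under eq_bigr do rewrite mulrBl -!mulrA.
rewrite sumrB -!mulr_sumr.
have L1 : L' (\sum_j c j * x j).
  by rewrite -(subKr z (\sum_j _)); apply: LB' => //; apply: LL'.
have := submoduleD sL' (LL' _ Lc') (LZ' _ _ (centreM (c'Z i) Zd) L1).
have L2 : L' (c' i * (c i * d - 1) * x i).
  by apply: IL'; apply: ideal_mulr => //; apply: ideal_mull.
move=> /LB' /(_ L2); congr L'.
rewrite !(bigD1_ord i) //= -!mulrA; set P := \sum_(j < k) _; set Q := \sum_(j < k) _.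
have cd := (centreP d).1 Zd (c i).
by rewrite -cd; ncring.
Qed.

(** Each strict inclusion lowers the codimension bound by one. *)
Lemma submodule_acc k (L : nat -> set R) :
    (forall n, submodule_above (L n)) -> (forall n, L n `<=` L n.+1) ->
  codim_le k (L 0%N) -> exists n, L n.+1 `<=` L n.
Proof.
move=> sL incL kL; apply: contrapT => /forallNP strictL.
have drop n j : codim_le j (L n) -> exists2 j', j = j'.+1 & codim_le j' (L n.+1).
  have /existsNP[z /not_implyP[Lz nLz]] := strictL n.
  exact: (codim_drop (sL _) (sL _) (incL _) Lz nLz).
elim: k 0%N kL => [|k IHk] n /drop[] // j [<-]; exact: IHk.
Qed.

(** Otherwise L (k+1), ..., L 0 would be a chain of k + 1 strict inclusions starting at codimension
    at most k. *)
Lemma submodule_dcc k (L : nat -> set R) :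
    (forall n, submodule_above (L n)) -> (forall n, L n.+1 `<=` L n) ->
  codim_le k (L k.+1) -> exists n, L n `<=` L n.+1.
Proof.
move=> sL decL kL; apply: contrapT => /forallNP strictL.
have drop n j : codim_le j (L n.+1) -> exists2 j', j = j'.+1 & codim_le j' (L n).
  have /existsNP[z /not_implyP[Lz nLz]] := strictL n.
  exact: (codim_drop (sL _) (sL _) (decL _) Lz nLz).
by elim: k kL => [|k IHk] /drop[] // j [<-].
Qed.

Lemma codim_leS k (L L' : set R) : L `<=` L' -> codim_le k L -> codim_le k L'.
Proof.
move=> LL' [x xP]; exists x => s; have [c cZ Lc] := xP s.
by exists c => //; apply: LL'.
Qed.

Definition unit_mod x := exists2 y, I (x * y - 1) & I (y * x - 1).

Definition principal_right x : set R := [set z | exists y, I (z - x * y)].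

Lemma principal_right_submodule x : submodule_above (principal_right x).
Proof.
split=> [z Iz|y z [y' Iy] [z' Iz]|c z /centreP cC [z' Iz]].
- by exists 0; rewrite mulr0 subr0.
- exists (y' - z'); have -> : y - z - x * (y' - z') = (y - x * y') - (z - x * z').
    by ncring.
  exact: ideal_sub.
- exists (c * z'); have -> : c * z - x * (c * z') = c * (z - x * z').
    by rewrite mulrA -cC; ncring.
  exact: ideal_mull.
Qed.

Lemma right_annihilator_submodule x : submodule_above [set z | I (x * z)].
Proof.
split=> [z Iz|y z Iy Iz|c z /centreP cC Iz] /=.
- exact: ideal_mull.
- by rewrite mulrBr; apply: ideal_sub.
- by rewrite mulrA -cC -mulrA; apply: ideal_mull.
Qed.

Variable k0 : nat.
Hypothesis codimI : codim_le k0 I.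

Lemma codim_above L : submodule_above L -> codim_le k0 L.
Proof. by case=> IL _ _; apply: codim_leS codimI. Qed.

(** R / I is Dedekind finite: the kernels of the y^n stabilize, which with y^n x^n = 1 makes left
    multiplication by y injective, and y (xy - 1) = (yx - 1) y vanishes. *)
Lemma left_inverse_mod x y : I (y * x - 1) -> I (x * y - 1).
Proof.
move=> Iyx; have Iyxn n : I (y ^+ n * x ^+ n - 1).
  elim: n => [|n IHn]; first by rewrite !expr0 mulr1 subrr; apply: ideal_zero.
  rewrite exprSr exprS.
  have -> : y ^+ n * y * (x * x ^+ n) - 1 =
      y ^+ n * (y * x - 1) * x ^+ n + (y ^+ n * x ^+ n - 1) by ncring.
  by apply: ideal_add => //; apply: ideal_mulr => //; apply: ideal_mull.
have [|n Ln] := @submodule_acc k0 (fun n => [set z | I (y ^+ n * z)])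
  (fun n => right_annihilator_submodule _) _ (codim_above (right_annihilator_submodule _)).
  by move=> n z /= Iz; rewrite exprS -mulrA; apply: ideal_mull.
have inj z : I (y * z) -> I z.
  move=> Iyz; have /Ln /= : I (y ^+ n.+1 * (x ^+ n * z)).
    have -> : y ^+ n.+1 * (x ^+ n * z) = y * (y ^+ n * x ^+ n - 1) * z + y * z.
      by rewrite exprS; ncring.
    by apply: ideal_add => //; apply: ideal_mulr => //; apply: ideal_mull.
  move=> H; have -> : z = y ^+ n * (x ^+ n * z) - (y ^+ n * x ^+ n - 1) * z by ncring.
  by apply: ideal_sub => //; apply: ideal_mulr.
apply: inj; have -> : y * (x * y - 1) = (y * x - 1) * y by ncring.
exact: ideal_mulr.
Qed.

Lemma unit_mod_right x y : I (x * y - 1) -> unit_mod x.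
Proof. by move=> Ixy; exists y => //; apply: left_inverse_mod. Qed.

Lemma unit_mod_left x y : I (y * x - 1) -> unit_mod x.
Proof. by move=> Iyx; exists y => //; apply: left_inverse_mod. Qed.

(** If left multiplication by x were injective modulo I, the chain of the x^n R would stop with x^n
    = x^(n+1) q, and cancelling x^n would give xq = 1. *)
Lemma kernel_of_nonunit x : ~ unit_mod x -> exists2 z, ~ I z & I (x * z).
Proof.
move=> nUx; apply: contrapT => /forall2NP kerx.
have {}kerx z : I (x * z) -> I z by case: (kerx z) => // /contrapT.
have [|n /(_ (x ^+ n))[|q Iq]] := @submodule_dcc k0
  (fun n => principal_right (x ^+ n)) (fun n => principal_right_submodule _) _
  (codim_above (principal_right_submodule _)).
- move=> n z [y Iz]; exists (x * y); move: Iz; rewrite exprSr mulrA; exact.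
- by exists 1; rewrite mulr1 subrr; apply: ideal_zero.
apply: nUx; apply: (@unit_mod_right _ q).
have {Iq} : I (x ^+ n * (x * q - 1)).
  by have -> : x ^+ n * (x * q - 1) = - (x ^+ n - x ^+ n.+1 * q);
    [rewrite exprSr; ncring|apply: ideal_opp].
elim: n => [|n IHn]; first by rewrite expr0 mul1r.
by rewrite exprS -mulrA => /kerx.
Qed.

Lemma unit_mod_1Bnilpotent w n : I (w ^+ n) -> unit_mod (1 - w).
Proof.
move=> Iw; apply: (@unit_mod_right _ (\sum_(i < n) w ^+ i)).
set t := \sum_(i < n) _.
have -> : (1 - w) * t - 1 = - ((w - 1) * t + 1) by ncring.
by rewrite /t -subrX1 subrK; apply: ideal_opp.
Qed.

(** A Fitting argument: the chain of the w^n B stops, which gives p with w^n = w^(n+1) p modulo I,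
    and (wp)^(n+1) is the idempotent. *)
Lemma idempotent_of_nonnilpotent w : (forall n, ~ I (w ^+ n)) ->
  exists p, I (w * p * (w * p) - w * p) /\ ~ I (w * p).
Proof.
move=> nilw.
(* The bicommutant of w makes the quotient p below commute with w. *)
pose B := [set p : R | forall v, w * v = v * w -> p * v = v * p].
pose L n := [set z | exists2 p, B p & I (z - w ^+ n * p)].
have BM p q : B p -> B q -> B (p * q).
  by move=> Bp Bq v wv; rewrite -mulrA Bq // mulrA Bp // mulrA.
have Bw : B w by [].
have sL n : submodule_above (L n).
  split=> [z Iz|y z [p Bp Iy] [q Bq Iz]|c z cZ [q Bq Iz]].
  - by exists 0; [move=> v _; rewrite mulr0 mul0r|rewrite mulr0 subr0].
  - exists (p - q); first by move=> v wv; rewrite mulrBl mulrBr Bp // Bq.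
    have -> : y - z - w ^+ n * (p - q) = (y - w ^+ n * p) - (z - w ^+ n * q) by ncring.
    exact: ideal_sub.
  - move/centreP: cZ => cC; exists (c * q); first by apply: BM => // v _.
    have -> : c * z - w ^+ n * (c * q) = c * (z - w ^+ n * q).
      by rewrite mulrA -cC; ncring.
    exact: ideal_mull.
have [|n /(_ (w ^+ n))[|p Bp Ip]] := @submodule_dcc k0 L sL _ (codim_above (sL _)).
- move=> n z [p Bp Iz]; exists (w * p); first exact: BM.
  by move: Iz; rewrite exprSr mulrA.
- by exists 1; [move=> v _; rewrite mulr1 mul1r|rewrite mulr1 subrr; apply: ideal_zero].
have wp : w * p = p * w by rewrite Bp.
pose t := w * p; pose N := n.+1.
have It m : I (w ^+ N - w ^+ N * t ^+ m).
  elim: m => [|m IHm]; first by rewrite expr0 mulr1 subrr; apply: ideal_zero.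
  have -> : w ^+ N - w ^+ N * t ^+ m.+1 = (w ^+ N - w ^+ N * t ^+ m) * t
      + w * (w ^+ n - w ^+ n.+1 * p).
    rewrite [t ^+ m.+1]exprSr mulrBr -exprS (mulrA w) -exprS [w ^+ n.+2]exprSr.
    by rewrite -/N /t; move: (_ ^+ m) (w ^+ N) => u v; ncring.
  by apply: ideal_add => //; [apply: ideal_mulr|apply: ideal_mull].
have tE : t ^+ N = w ^+ N * p ^+ N by rewrite exprMn_comm.
have ptN : p ^+ N * t ^+ N = t ^+ N * p ^+ N.
  by apply: commrX; apply/commr_sym/commrX; rewrite /GRing.comm /t mulrA -wp.
(* Chosen so that w times it is w^N p^N = t^N. *)
exists (w ^+ n * p ^+ N).
have -> : w * (w ^+ n * p ^+ N) = t ^+ N by rewrite mulrA -exprS -tE.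
split.
  have -> : t ^+ N * t ^+ N - t ^+ N = - ((w ^+ N - w ^+ N * t ^+ N) * p ^+ N).
    rewrite {1 3}tE -mulrA ptN; ncring.
  by apply: ideal_opp => //; apply: ideal_mulr.
move=> IE; apply: (nilw N); rewrite -(subrK (w ^+ N * t ^+ N) (w ^+ N)).
by apply: ideal_add => //; apply: ideal_mull.
Qed.

(** Otherwise each te is x (f t) for some f; iterating f from 1 gives x^n (t_n e) = e, hence x^(n+1)
    (t_n e) = xe = 0, and stability of the kernels of the x^n forces e = 0 modulo I. *)
Lemma image_misses_idempotent x e : I (x * e) -> I (e * e - e) -> ~ I e ->
  exists t, forall y, ~ I (t * e - x * y).
Proof.
move=> Ixe Iee nIe; apply: contrapT => /forallNP H.
have {H} /choice[f fP] : forall t, exists y, I (t * e - x * y).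
  by move=> t; have /existsNP[y /contrapT] := H t; exists y.
pose t n := iter n f 1.
have tP n : I (x ^+ n * (t n * e) - e).
  elim: n => [|n IHn]; first by rewrite expr0 !mul1r subrr; apply: ideal_zero.
  have -> : x ^+ n.+1 * (t n.+1 * e) - e =
      (x ^+ n * (t n * e) - e) * e + (e * e - e)
      - x ^+ n * (t n * e - x * t n.+1) * e.
    by rewrite exprSr; ncring.
  apply: ideal_sub => //; first by apply: ideal_add => //; apply: ideal_mulr.
  by apply: ideal_mulr => //; apply: ideal_mull => //; apply: fP.
have [|n Ln] := @submodule_acc k0 (fun n => [set z | I (x ^+ n * z)])
  (fun n => right_annihilator_submodule _) _ (codim_above (right_annihilator_submodule _)).
  by move=> n z /= Iz; rewrite exprS -mulrA; apply: ideal_mull.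
have /Ln /= : I (x ^+ n.+1 * (t n * e)).
  have -> : x ^+ n.+1 * (t n * e) = x * (x ^+ n * (t n * e) - e) + x * e.
    by rewrite exprS; ncring.
  by apply: ideal_add => //; apply: ideal_mull.
by move/(ideal_sub idI)/(_ (tP n)); rewrite subKr.
Qed.

(** The Jacobson radical of R / I is zero. *)
Hypothesis semisimpleI : forall z, (forall a, unit_mod (1 + z * a)) -> I z.

(** The kernel of x contains a nonzero idempotent e modulo I, and then dbe = e. For te outside xR,
    the correction c = ted gives x' = x + cb with x' e = te and xR inside x' R, so the image grows
    strictly. *)
Lemma enlarge_image k x a d b : I (a * x + d * b - 1) -> ~ unit_mod x ->
    codim_le k (principal_right x) ->
  exists c k', [/\ k = k'.+1, codim_le k' (principal_right (x + c * b))
    & I (a * (x + c * b) + (d - a * c) * b - 1)].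
Proof.
move=> Iab nUx kx; have [z nIz Ixz] := kernel_of_nonunit nUx.
have /existsNP[r nUr] : ~ forall r, unit_mod (1 + z * r) by move/semisimpleI.
have nilw n : ~ I ((- (z * r)) ^+ n).
  by move/unit_mod_1Bnilpotent; rewrite opprK.
have [p [Iee nIe]] := idempotent_of_nonnilpotent nilw.
set e := (_ * p) in Iee nIe.
have Ixe : I (x * e).
  have -> : x * e = x * z * (- (r * p)) by rewrite /e; ncring.
  exact: ideal_mulr.
have [t tP] := image_misses_idempotent Ixe Iee nIe.
have Ibe : I (d * b * e - e).
  have -> : d * b * e - e = (a * x + d * b - 1) * e - a * (x * e) by ncring.
  by apply: ideal_sub => //; [apply: ideal_mulr|apply: ideal_mull].
exists (t * e * d); set x' := x + _.
have L'te : principal_right x' (t * e).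
  exists e; have -> : t * e - x' * e = - (x * e) - t * e * (d * b * e - e)
      - t * (e * e - e) by rewrite /x'; ncring.
  apply: ideal_sub => //; last exact: ideal_mull.
  by apply: ideal_sub => //; [apply: ideal_opp|apply: ideal_mull].
have sub : principal_right x `<=` principal_right x'.
  (* Subtracting a multiple of e does not change the product with x, and makes edb vanish on the
     result modulo I. *)
  move=> u [y Iu]; exists (y - e * d * b * y).
  have -> : u - x' * (y - e * d * b * y) = (u - x * y) + x * e * (d * b * y)
      + t * e * (d * b * e - e) * (d * b * y) + t * (e * e - e) * (d * b * y).
    by rewrite /x'; ncring.
  apply: ideal_add => //; last by apply: ideal_mulr => //; apply: ideal_mull.
  apply: ideal_add => //; last by apply: ideal_mulr => //; apply: ideal_mull.
  by apply: ideal_add => //; apply: ideal_mulr.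
have nLte : ~ principal_right x (t * e) by case=> y /tP.
have [k' Ek kx'] := codim_drop (principal_right_submodule _)
  (principal_right_submodule _) sub L'te nLte kx.
exists k'; split=> //; move: Iab; congr (I _); rewrite /x'; ncring.
Qed.

(** Induction on the codimension of xR, which [enlarge_image] lowers as long as x is not a unit. *)
Lemma stable_rank1_semisimple x a d b :
  I (a * x + d * b - 1) -> exists c, unit_mod (x + c * b).
Proof.
have [k] : exists k, codim_le k (principal_right x).
  by exists k0; apply/codim_above/principal_right_submodule.
elim: k x d => [|k IHk] x d kx Iab.
  exists 0; rewrite mul0r addr0; apply: contrapT => nUx.
  by have [c [k' []]] := enlarge_image Iab nUx kx.
have [Ux|nUx] := pselect (unit_mod x); first by exists 0; rewrite mul0r addr0.
have [c [k' [[<-] kx' Iab']]] := enlarge_image Iab nUx kx.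
have [c' Uc'] := IHk _ _ kx' Iab'.
by exists (c + c'); rewrite mulrDl addrA.
Qed.

End FiniteLength.

(** * The Jacobson radical modulo an ideal *)

Section JacobsonRadical.
Variables (R : pzRingType) (I : set R) (k : nat).
Local Notation Z := (centre [set: R]).
Hypothesis idI : two_sided_ideal I.
Hypothesis fieldI : forall c, Z c -> I c \/ exists2 d, Z d & I (c * d - 1).
Hypothesis codimI : codim_le k I.

Definition jacobson : set R := [set z | forall a, unit_mod I (1 + z * a)].

Let right_unit := unit_mod_right idI fieldI codimI.
Let left_unit := unit_mod_left idI fieldI codimI.

Lemma sub_jacobson : I `<=` jacobson.
Proof.
move=> z Iz a; apply: (@right_unit _ 1); rewrite mulr1 addrAC subrr add0r.
exact: ideal_mulr.
Qed.

(** One-sided inverses suffice by Dedekind finiteness. For left multiples, 1 - r u z a inverts 1 + r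
    z a when u inverts 1 + z a r. *)
Lemma jacobson_ideal : two_sided_ideal jacobson.
Proof.
have JN z : jacobson z -> jacobson (- z).
  by move=> Jz a; rewrite mulNr -mulrN; apply: Jz.
split=> [|z z' Jz /JN Jz' a|r z Jz]; first by apply: sub_jacobson; apply: ideal_zero.
- have [v Iv Iv'] := Jz a; have [u Iu Iu'] := Jz' (a * v).
  apply: (@left_unit _ (v * u)).
  have -> : v * u * (1 + (z - z') * a) - 1 =
      v * (u * (1 + - z' * (a * v)) - 1) * (1 + z * a) + (v * (1 + z * a) - 1)
      + v * u * (- z') * a * (- (v * (1 + z * a) - 1)) by ncring.
  apply: ideal_add => //; last by apply: ideal_mull => //; apply: ideal_opp.
  by apply: ideal_add => //; apply: ideal_mulr => //; apply: ideal_mull.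
- split=> a; last by rewrite -mulrA; apply: Jz.
  have [u Iu _] := Jz (a * r); apply: (@right_unit _ (1 - r * u * z * a)).
  have -> : (1 + r * z * a) * (1 - r * u * z * a) - 1 =
      - (r * ((1 + z * (a * r)) * u - 1) * (z * a)) by ncring.
  by apply: ideal_opp => //; apply: ideal_mulr => //; apply: ideal_mull.
Qed.

Lemma unit_mod_jacobson x : unit_mod jacobson x -> unit_mod I x.
Proof.
case=> y /(_ 1); rewrite mulr1 addrC subrK => -[u Iu _] _.
by apply: (@right_unit _ (y * u)); rewrite mulrA.
Qed.

(** Replacing I by the preimage of the radical gives a semisimple quotient, and units lift back by
    [unit_mod_jacobson]. *)
Lemma stable_rank1_mod x a b :
  I (a * x + b - 1) -> exists c, unit_mod I (x + c * b).
Proof.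
move=> Iab; have fieldJ c : Z c -> jacobson c \/ exists2 d, Z d & jacobson (c * d - 1).
  move=> /fieldI[/sub_jacobson|[d Zd /sub_jacobson Jd]]; [left|right] => //.
  by exists d.
have [||c Uc] := @stable_rank1_semisimple R jacobson jacobson_ideal fieldJ k
  (codim_leS sub_jacobson codimI) _ x a 1 b.
- move=> z Jz a'; apply: unit_mod_jacobson; exact: Jz.
- by rewrite mul1r; apply: sub_jacobson.
- by exists c; apply: unit_mod_jacobson.
Qed.

End JacobsonRadical.

(** * Maximal ideals of the centre and localization *)

Section MaximalIdeals.
Variable R : pzRingType.
Local Notation Z := (centre [set: R]).

Definition centre_ideal (S X : set R) :=
  [/\ X `<=` centre S, X 0, forall x y, X x -> X y -> X (x - y)
    & forall c x, centre S c -> X x -> X (c * x)].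

Definition centre_maximal (m : set R) := [/\ centre_ideal [set: R] m, ~ m 1
  & forall c, Z c -> ~ m c -> exists2 d, Z d & m (c * d - 1)].

(** Zorn's lemma is applied to sets Y whose union with X is a proper ideal, so that the empty chain
    is covered as well. *)
Lemma exists_centre_maximal (X : set R) : centre_ideal [set: R] X -> ~ X 1 ->
  exists2 m, centre_maximal m & X `<=` m.
Proof.
move=> idX nX1; pose P Y := centre_ideal [set: R] (X `|` Y) /\ ~ (X `|` Y) 1.
have [F FP totF|M [[idM nM1] maxM]] := @Zorn_bigcup _ P.
  have inF x y : (X `|` \bigcup_(Y in F) Y) x -> (X `|` \bigcup_(Y in F) Y) y ->
      exists Y, [/\ P Y, (X `|` Y) x, (X `|` Y) y &
        X `|` Y `<=` X `|` \bigcup_(Y in F) Y].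
    have sub Y : F Y -> X `|` Y `<=` X `|` \bigcup_(Y in F) Y.
      by move=> FY z [Xz|Yz]; [left|right; exists Y].
    case=> [Xx|[Y1 FY1 Yx]] [Xy|[Y2 FY2 Yy]].
    - exists set0; split; try by left.
      + by rewrite /P setU0.
      + by rewrite setU0 => z; left.
    - by exists Y2; split; [apply: FP|left|right|apply: sub].
    - by exists Y1; split; [apply: FP|right|left|apply: sub].
    - have [Y12|Y21] := totF _ _ FY1 FY2.
      + by exists Y2; split; [apply: FP|right; apply: Y12|right|apply: sub].
      + by exists Y1; split; [apply: FP|right|right; apply: Y21|apply: sub].
  split; last by move=> H; have [Y [[_ nY1] ? _ _]] := inF _ _ H H.
  split=> [x|||c x Zc].
  - by move=> H; have [Y [[[YZ _ _ _] _] ? _ _]] := inF _ _ H H; apply: YZ.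
  - by left; case: idX.
  - move=> x y Hx Hy; have [Y [[[_ _ YB _] _] Yx Yy]] := inF _ _ Hx Hy.
    by apply; apply: YB.
  - move=> H; have [Y [[[_ _ _ YM] _] Yx _]] := inF _ _ H H.
    by apply; apply: YM.
exists (X `|` M); last by move=> z; left.
split=> // c Zc nMc; have [MZ M0 MB MM] := idM.
(* The ideal generated by c and the ideal found; by maximality it contains 1, which yields the
   inverse of c. *)
pose B := [set z | exists2 x, (X `|` M) x & exists2 d, Z d & z = x + c * d].
have XB : X `|` M `<=` B.
  by move=> x Mx; exists x => //; exists 0; rewrite ?mulr0 ?addr0 //; apply: centre0.
have Bc : B c by exists 0 => //; exists 1; rewrite ?mulr1 ?add0r //; apply: centre1.
have idB : centre_ideal [set: R] B.
  split=> [_ [x /MZ Zx [d Zd ->]]||_ _ [x Mx [d Zd ->]] [y My [e Ze ->]]|].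
  - rewrite -[c * d]opprK; apply: centreB => //; rewrite -sub0r.
    by apply: centreB; [apply: centre0|apply: centreM].
  - exact: XB.
  - exists (x - y); first exact: MB.
    by exists (d - e); [apply: centreB|ncring].
  - move=> d _ Zd [x Mx [e Ze ->]]; exists (d * x); first exact: MM.
    exists (d * e); first exact: centreM.
    by rewrite mulrDr !mulrA ((centreP d).1 Zd c).
have UB : X `|` B = B by apply/setUidPr => z Xz; apply: XB; left.
have /maxM : M `<` B.
  split=> [z Mz|BM]; first by apply: XB; right.
  by apply: nMc; right; apply: BM.
rewrite /P UB => nPB; have /contrapT[x Mx [d Zd E]] : ~ ~ B 1 by move=> nB1; apply: nPB.
exists d => //; have -> : c * d - 1 = 0 - x by rewrite E; ncring.
exact: MB.
Qed.

Section Local.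
Variables (m : set R) (k : nat) (x : 'I_k -> R).
Hypothesis maxm : centre_maximal m.
Hypothesis genx : forall s, exists c : 'I_k -> R,
  (forall i, Z (c i)) /\ s = \sum_(i < k) c i * x i.

Let mZ c : m c -> Z c. Proof. by case: maxm => -[+ _ _ _] _ _; apply. Qed.
Let m0 : m 0. Proof. by case: maxm => -[]. Qed.
Let mB c d : m c -> m d -> m (c - d).
Proof. by case: maxm => -[_ _ + _] _ _; apply. Qed.
Let mM c d : Z c -> m d -> m (c * d).
Proof. by case: maxm => -[_ _ _ +] _ _; apply. Qed.
Let mD c d : m c -> m d -> m (c + d).
Proof. by move=> mc md; rewrite -[d]opprK -[- d]sub0r; apply: mB => //; apply: mB. Qed.

Lemma maximal_prime c d : Z c -> Z d -> ~ m c -> ~ m d -> ~ m (c * d).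
Proof.
move=> Zc Zd nmc nmd mcd; case: maxm => _ _ /(_ c Zc nmc)[c' Zc' mc']; apply: nmd.
have -> : d = c' * (c * d) - d * (c * c' - 1).
  by rewrite ((centreP c).1 Zc c') ((centreP d).1 Zd); ncring.
by apply: mB; apply: mM.
Qed.

(** This is mR. Coefficients in m on the fixed generators are the form that the elimination in
    [nakayama] starts from. *)
Definition extension : set R :=
  [set z | exists mu : 'I_k -> R, (forall i, m (mu i)) /\ z = \sum_i mu i * x i].

Lemma mem_extension c z : m c -> extension (c * z).
Proof.
move=> mc; have [d [Zd ->]] := genx z.
exists (fun i => c * d i); split=> [i|].
  by rewrite ((centreP c).1 (mZ mc)); apply: mM.
by rewrite mulr_sumr; apply: eq_bigr => i _; rewrite mulrA.
Qed.

Lemma extension_ideal : two_sided_ideal extension.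
Proof.
have extB z z' : extension z -> extension z' -> extension (z - z').
  move=> [mu [mmu ->]] [nu [mnu ->]]; exists (fun i => mu i - nu i).
  split=> [i|]; first exact: mB.
  by rewrite -sumrB; apply: eq_bigr => i _; rewrite mulrBl.
have ext0 : extension 0 by rewrite -(mul0r 0); apply: mem_extension.
have extS (F : 'I_k -> R) : (forall i, extension (F i)) -> extension (\sum_i F i).
  move=> extF; apply: big_ind => // a b ea eb.
  by rewrite -[b]opprK -[- b]sub0r; apply: (extB) => //; apply: extB.
split=> // r _ [mu [mmu ->]]; split.
- rewrite mulr_sumr; apply: extS => i.
  by rewrite mulrA -((centreP (mu i)).1 (mZ (mmu i))) -mulrA; apply: mem_extension.
- by rewrite mulr_suml; apply: extS => i; rewrite -mulrA; apply: mem_extension.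
Qed.

(** Nakayama's lemma localized at m, with denominators cleared. Generators are eliminated one at a
    time rather than by a determinant, each at the cost of a central factor outside m. *)
Lemma nakayama (N : set R) :
    (forall y z, N y -> N z -> N (y - z)) ->
    (forall c z, Z c -> N z -> N (c * z)) ->
    (forall z, exists2 t, N t & extension (z - t)) ->
  exists s, [/\ Z s, ~ m s & forall z, N (s * z)].
Proof.
move=> NB NM Next.
suff elim_gens j (y : 'I_j -> R) s : Z s -> ~ m s ->
    (forall z, exists2 mu : 'I_j -> R, forall i, m (mu i)
      & N (s * z - \sum_i mu i * y i)) ->
    exists s, [/\ Z s, ~ m s & forall z, N (s * z)].
  apply: (elim_gens k x 1); [exact: centre1|by case: maxm|move=> z].
  have [t Nt [mu [mmu E]]] := Next z; exists mu => //.
  by rewrite -E mul1r subKr.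
elim: j y s => [|j IHj] y s Zs nms sP.
  by exists s; split=> // z; have [mu _] := sP z; rewrite big_ord0 subr0.
(* For z = y_0 the relation puts (s - nu_0) y_0 into N plus m-combinations of the other
   generators. *)
have [nu mnu Nnu] := sP (y ord0).
have Zs' : Z (s - nu ord0) by apply: centreB => //; apply: mZ.
have nms' : ~ m (s - nu ord0).
  by move=> ms'; apply: nms; rewrite -(subrK (nu ord0) s); apply: mD.
apply: (IHj (fun i => y (lift ord0 i)) ((s - nu ord0) * s)).
- exact: centreM.
- exact: maximal_prime.
move=> z; have [mu mmu Nmu] := sP z.
exists (fun i => (s - nu ord0) * mu (lift ord0 i) + mu ord0 * nu (lift ord0 i)).
  by move=> i; apply: mD; apply: mM => //; apply: mZ.
have ND a b : N a -> N b -> N (a + b).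
  move=> Na Nb; rewrite -[b]opprK -[- b]sub0r; apply: (NB) => //.
  by apply: (NB) => //; rewrite -(subrr a); apply: NB.
have := ND _ _ (NM _ _ Zs' Nmu) (NM _ _ (mZ (mmu ord0)) Nnu).
congr N; rewrite !big_ord_recl.
under [in RHS]eq_bigr do rewrite mulrDl -!mulrA.
rewrite big_split /= -!mulr_sumr.
set q := mu ord0; set P := \sum_(i < j) mu _ * _; set Q := \sum_(i < j) nu _ * _.
have -> : q * (s * y ord0 - (nu ord0 * y ord0 + Q)) =
    q * (s - nu ord0) * y ord0 - q * Q by ncring.
by rewrite -((centreP _).1 Zs' q); ncring.
Qed.

(** Stable rank 1 modulo mR gives w = u + cb invertible modulo mR. Nakayama for wR and Rw yields s1
    = w y1 and s2 = y2 w, and y = y2 s1 = s2 y1 works on both sides with s = s1 s2. *)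
Lemma stable_rank1_local u a b : a * u + b = 1 ->
  exists c y s, [/\ Z s, ~ m s, (u + c * b) * y = s & y * (u + c * b) = s].
Proof.
move=> E; have ext0 := ideal_zero extension_ideal.
have fieldm c : Z c -> extension c \/ exists2 d, Z d & extension (c * d - 1).
  move=> Zc; have [mc|nmc] := pselect (m c).
    by left; rewrite -[c]mulr1; apply: mem_extension.
  right; case: maxm => _ _ /(_ c Zc nmc)[d Zd md]; exists d => //.
  by rewrite -[_ - 1]mulr1; apply: mem_extension.
have codimm : codim_le k extension.
  exists x => z; have [c [cZ ->]] := genx z; exists c => //.
  by rewrite subrr.
have [|c [v Iuv Ivu]] := @stable_rank1_mod _ _ k extension_ideal fieldm codimm u a b.
  by rewrite E subrr.
set w := u + c * b in Iuv Ivu *.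
have [||z|s1 [Zs1 nms1 /(_ 1)[y1]]] := @nakayama [set z | exists y, z = w * y].
- by move=> _ _ [y ->] [y' ->]; exists (y - y'); rewrite mulrBr.
- by move=> d _ Zd [y ->]; exists (d * y); rewrite !mulrA ((centreP d).1 Zd).
- exists (w * (v * z)); first by exists (v * z).
  have -> : z - w * (v * z) = - ((w * v - 1) * z) by ncring.
  by apply: ideal_opp; [apply: extension_ideal|apply: ideal_mulr => //; apply: extension_ideal].
rewrite mulr1 => E1.
have [||z|s2 [Zs2 nms2 /(_ 1)[y2]]] := @nakayama [set z | exists y, z = y * w].
- by move=> _ _ [y ->] [y' ->]; exists (y - y'); rewrite mulrBl.
- by move=> d _ Zd [y ->]; exists (d * y); rewrite !mulrA.
- exists (z * v * w); first by exists (z * v).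
  have -> : z - z * v * w = - (z * (v * w - 1)) by ncring.
  by apply: ideal_opp; [apply: extension_ideal|apply: ideal_mull => //; apply: extension_ideal].
rewrite mulr1 => E2.
have Ey : y2 * s1 = s2 * y1 by rewrite E1 E2 mulrA.
exists c, (y2 * s1), (s1 * s2); split; [exact: centreM|exact: maximal_prime| |].
- by rewrite Ey mulrA -((centreP s2).1 Zs2) -mulrA -E1 ((centreP s2).1 Zs2).
- by rewrite -((centreP s1).1 Zs1) -mulrA -E2.
Qed.

End Local.
End MaximalIdeals.

(* If the denominators s did not generate the unit ideal of the centre, they would lie
   in a maximal ideal m, against stable rank 1 of R / mR. *)
Lemma stable_rank1_cover_full (R : pzRingType) (X : set R) (a u b : R) :
    module_finite [set: R] -> centre_ideal [set: R] X -> a * u + b = 1 ->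
    (forall c y s, centre [set: R] s -> (u + c * b) * y = s ->
       y * (u + c * b) = s -> X s) ->
  X 1.
Proof.
move=> [k [x [_ genx]]] idX E HX; apply: contrapT => /(exists_centre_maximal idX)[m maxm Xm].
have gen s : exists c : 'I_k -> R, (forall i, centre [set: R] (c i)) /\
    s = \sum_(i < k) c i * x i by apply: genx.
have [c [y [s [Zs nms E1 E2]]]] := stable_rank1_local maxm gen E.
by apply: nms; apply: Xm; apply: HX E1 E2.
Qed.

(** * Transfer to a subring *)

Section Subring.
Variables (R : pzRingType) (S : set R).
Hypothesis ringS : GRing.subring_closed (mem S).

(** The closure proof is a parameter so that the ring structure of [subring_type] can be inferred
    from the type. *)
Definition subring_pred (_ : GRing.subring_closed (mem S)) : {pred R} := mem S.

Definition subring_type := {x : R | x \in subring_pred ringS}.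
HB.instance Definition _ := Choice.on subring_type.
HB.instance Definition _ := SubType.on subring_type.
HB.instance Definition _ :=
  GRing.SubChoice_isSubPzRing.Build R (subring_pred ringS) subring_type ringS.

Let f : {rmorphism subring_type -> R} := val.

Let f_inj : injective f. Proof. exact: val_inj. Qed.

Let f_mem z : S (f z). Proof. exact: (set_mem (valP z)). Qed.

Let f_lift z : S z -> exists z', f z' = z.
Proof.
by move=> Sz; have /mem_set Sz' := Sz; exists (Sub z Sz'); apply: SubK.
Qed.

Let f_centre z : centre [set: subring_type] z <-> centre S (f z).
Proof.
split=> [/centreP zC|[_ zC]]; last first.
  by apply/centreP => s; apply: f_inj; rewrite !rmorphM; apply: zC; apply: f_mem.
split=> [|s /f_lift[s' <-]]; first exact: f_mem.
by rewrite -!rmorphM zC.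
Qed.

Lemma stable_rank1_cover (X : set R) (a u b : R) :
    module_finite S -> centre_ideal S X -> S a -> S u -> S b -> a * u + b = 1 ->
    (forall c y s, S c -> S y -> centre S s -> (u + c * b) * y = s ->
       y * (u + c * b) = s -> X s) ->
  X 1.
Proof.
move=> [k [x [Sx genx]]] [XZ X0 XB XM].
move=> /f_lift[a' <-] /f_lift[u' <-] /f_lift[b' <-] E HX.
rewrite -(rmorph1 f).
apply: (@stable_rank1_cover_full subring_type (fun z => X (f z)) a' u' b').
- have /choice[x' x'E] i : exists x', f x' = x i by apply/f_lift/Sx.
  exists k, x'; split=> // s _; have [c [cZ Es]] := genx _ (f_mem s).
  have /choice[c' c'E] i : exists c', f c' = c i by apply: f_lift; case: (cZ i).
  exists c'; split=> [i|]; first by apply/f_centre; rewrite c'E.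
  apply: f_inj; rewrite Es rmorph_sum; apply: eq_bigr => i _.
  by rewrite rmorphM c'E x'E.
- split=> [z /XZ||z w|c z /f_centre].
  + by move/f_centre.
  + by rewrite rmorph0.
  + by rewrite rmorphB; apply: XB.
  + by rewrite rmorphM; apply: XM.
- by apply: f_inj; rewrite rmorphD rmorphM rmorph1.
- move=> c y s /f_centre Zs E1 E2.
  by apply: (HX (f c) (f y)) => //; rewrite -!(rmorphM, rmorphD) ?E1 ?E2.
Qed.

End Subring.

(** * Subgroups, normalization and commutators *)

Ltac group_simp :=
  rewrite /commutator !(invgM, invgK, mulgA, mulgK, mulgVK, mulgV, mulVg, mul1g,
    mulg1, invg1).

Section Subgroups.
Variable G : groupType.
Implicit Types (H K E X : set G) (x y : G).
Local Open Scope group_scope.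

Lemma subgroupP H : subgroup H <-> H 1 /\ forall x y, H x -> H y -> H (x * y^-1).
Proof.
split=> [[/set_mem H1 HM]|[H1 HM]].
  by split=> // x y /mem_set Hx /mem_set Hy; apply/set_mem/HM.
split; first exact: mem_set.
by move=> x y /set_mem Hx /set_mem Hy; apply/mem_set/HM.
Qed.

Lemma subgroup1 H : subgroup H -> H 1.
Proof. by case/subgroupP. Qed.

Lemma subgroupV H x : subgroup H -> H x -> H x^-1.
Proof. by case/subgroupP => H1 HM Hx; rewrite -[_^-1]mul1g; apply: HM. Qed.

Lemma subgroupM H x y : subgroup H -> H x -> H y -> H (x * y).
Proof.
move=> sH Hx Hy; rewrite -[y]invgK; case/subgroupP: (sH) => _; apply=> //.
exact: subgroupV.
Qed.

Lemma subgroupI H : H 1 -> (forall x y, H x -> H y -> H (x * y)) ->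
  (forall x, H x -> H x^-1) -> subgroup H.
Proof.
by move=> H1 HM HV; apply/subgroupP; split=> // x y Hx /HV Hy; apply: HM.
Qed.

Lemma generated_subgroup X : subgroup (generated X).
Proof.
apply: subgroupI => [M [sM _]|x y gx gy M XM|x gx M XM]; first exact: subgroup1.
- by case: (XM) => sM _; apply: subgroupM (gx _ XM) (gy _ XM).
- by case: (XM) => sM _; apply: subgroupV (gx _ XM).
Qed.

Lemma mem_generated X x : X x -> generated X x.
Proof. by move=> Xx M [_]; apply. Qed.

Lemma generated_sub X H : subgroup H -> X `<=` H -> generated X `<=` H.
Proof. exact: smallest_sub. Qed.

Lemma commutatorV x y : (commutator x y)^-1 = commutator y x.
Proof. by group_simp. Qed.

Definition normalizes E H := forall e h, E e -> H h -> H (e * h * e^-1).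

(** Conjugation by x may map H properly into itself, hence the condition on both x and its
    inverse. *)
Lemma normalizes_generated X H : subgroup H ->
    (forall x h, X x -> H h -> H (x * h * x^-1) /\ H (x^-1 * h * x)) ->
  normalizes (generated X) H.
Proof.
move=> sH XH e h Ee Hh.
suff: generated X `<=` [set e | forall h, H h -> H (e * h * e^-1) /\ H (e^-1 * h * e)].
  by move=> /(_ e Ee h Hh)[].
apply: generated_sub => [|x Xx k Hk]; last exact: XH.
apply: subgroupI => [k Hk|x y Nx Ny k Hk|x Nx k Hk] /=.
- by rewrite invg1 !mulg1 !mul1g.
- split; [have /Nx[+ _] := (Ny _ Hk).1|have /Ny[_ +] := (Nx _ Hk).2];
    by rewrite !invgM !mulgA.
- by rewrite invgK; have [] := Nx _ Hk.
Qed.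

(* For x fixed, y |-> [x, y] is multiplicative up to conjugation by y. *)
Lemma commutator_preimage E H x : subgroup E -> subgroup H -> normalizes E H ->
  subgroup [set y | E y /\ H (commutator x y)].
Proof.
move=> sE sH EH; apply: subgroupI => [|y z [Ey Hy] [Ez Hz]|y [Ey Hy]] /=.
- by split; [|group_simp]; apply: subgroup1.
- split; first exact: subgroupM.
  have -> : commutator x (y * z) = commutator x y * (y * commutator x z * y^-1).
    by group_simp.
  by apply: subgroupM => //; apply: EH.
- split; first exact: subgroupV.
  have -> : commutator x y^-1 = y^-1 * (commutator x y)^-1 * y^-1^-1 by group_simp.
  by apply: EH; apply: subgroupV.
Qed.

(** The computation in a quotient by K, written out because K is normalized by E but need not be
    contained in it. *)
Lemma commutator_cong E K k x k' y : subgroup E -> subgroup K -> normalizes E K ->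
    K k -> K k' -> E x -> E y ->
  K (commutator (k * x) (k' * y) * (commutator x y)^-1).
Proof.
move=> sE sK EK Kk Kk' Ex Ey.
have Exyx : E (x * y * x^-1).
  by apply: subgroupM => //; [apply: subgroupM|apply: subgroupV].
have Exy : E (commutator x y) by apply: subgroupM => //; apply: subgroupV.
have -> : commutator (k * x) (k' * y) * (commutator x y)^-1 =
    k * (x * k' * x^-1) * (x * y * x^-1 * k^-1 * (x * y * x^-1)^-1)
    * (commutator x y * k'^-1 * (commutator x y)^-1) by group_simp.
apply: subgroupM => //; last by apply: EK => //; apply: subgroupV.
apply: subgroupM => //; last by apply: EK => //; apply: subgroupV.
by apply: subgroupM => //; apply: EK.
Qed.

End Subgroups.

(** * Unipotent matrices and relative elementary subgroups *)

Section Unipotents.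
Variables (n : nat) (R : pzRingType).
Local Notation "'col_ i" := (delta_mx i 0 : 'cV[R]_n) (at level 8, i at level 2).
Local Notation "'row_ i" := (delta_mx 0 i : 'rV[R]_n) (at level 8, i at level 2).
Implicit Types (g : GL n R) (u : 'cV[R]_n) (v : 'rV[R]_n) (c : R) (i j k l : 'I_n).

(* Meaningful only if vu = 0; the junk value is 1 when e - uv is not inverse to e + uv. *)
Definition unipotent u v : GL n R :=
  insubd (1%g : GL n R) (1%:M + u *m v, 1%:M - u *m v).

Lemma unipotentE u v : v *m u = 0 -> GL_mx (unipotent u v) = 1%:M + u *m v.
Proof.
move=> vu; rewrite /unipotent /GL_mx.
have uvuv : u *m v *m (u *m v) = 0 by rewrite mulmxA -(mulmxA u) vu mulmx0 mul0mx.
rewrite [X in X.1](_ : _ = (1%:M + u *m v, 1%:M - u *m v)) //.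
rewrite -/(val _) insubdK // unfold_in /inverse_pair /=.
rewrite mulmxDl mul1mx mulmxBr mulmx1 uvuv subr0 subrK.
by rewrite mulmxBl mul1mx mulmxDr mulmx1 uvuv addr0 addrK eqxx.
Qed.

Lemma unipotent_prod u v u' v' : u *m v = u' *m v' -> unipotent u v = unipotent u' v'.
Proof. by rewrite /unipotent => ->. Qed.

Lemma GL_mxM g h : GL_mx (g * h)%g = GL_mx g *m GL_mx h. Proof. by []. Qed.
Lemma GL_mx1 : GL_mx (1%g : GL n R) = 1%:M. Proof. by []. Qed.
Lemma GL_mxV g : GL_mx g^-1%g *m GL_mx g = 1%:M. Proof. exact: GL_Vmul. Qed.
Lemma GL_mxVr g : GL_mx g *m GL_mx g^-1%g = 1%:M. Proof. exact: GL_mulV. Qed.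

Lemma unipotent0 v : unipotent 0 v = 1%g.
Proof. by apply: GL_mx_inj; rewrite unipotentE ?mulmx0 // mul0mx addr0. Qed.

Lemma unipotentDl u u' v : v *m u = 0 -> v *m u' = 0 ->
  unipotent (u + u') v = (unipotent u v * unipotent u' v)%g.
Proof.
move=> vu vu'; apply: GL_mx_inj; rewrite GL_mxM !unipotentE // ?mulmxDr ?vu ?vu' ?addr0 //.
rewrite !(mulmxDl, mulmxDr, mul1mx, mulmx1) mulmxA -(mulmxA u) vu' mulmx0 mul0mx addr0.
by rewrite addrA addrAC.
Qed.

Lemma unipotentDr u v v' : v *m u = 0 -> v' *m u = 0 ->
  unipotent u (v + v') = (unipotent u v * unipotent u v')%g.
Proof.
move=> vu vu'; apply: GL_mx_inj; rewrite GL_mxM !unipotentE // ?mulmxDl ?vu ?vu' ?addr0 //.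
rewrite !(mulmxDl, mulmxDr, mul1mx, mulmx1) mulmxA -(mulmxA u) vu mulmx0 mul0mx addr0.
by rewrite addrA addrAC.
Qed.

Lemma unipotentV u v : v *m u = 0 -> ((unipotent u v)^-1)%g = unipotent (- u) v.
Proof.
move=> vu; have vNu : v *m - u = 0 by rewrite mulmxN vu oppr0.
apply: (mulgI (unipotent u v)).
by rewrite mulgV -unipotentDl // subrr unipotent0.
Qed.

Lemma unipotentJ g u v : v *m u = 0 ->
  (g * unipotent u v * g^-1)%g = unipotent (GL_mx g *m u) (v *m GL_mx g^-1%g).
Proof.
move=> vu; apply: GL_mx_inj; rewrite !GL_mxM !unipotentE //.
  by rewrite !(mulmxDl, mulmxDr, mul1mx, mulmx1) GL_mxVr !mulmxA.
by rewrite mulmxA -(mulmxA v) GL_mxV mulmx1.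
Qed.

Lemma row_mul k u : 'row_k *m u = (u k 0)%:M.
Proof. by rewrite -rowE [LHS]mx11_scalar mxE. Qed.

Lemma mul_col v k : v *m 'col_k = (v 0 k)%:M.
Proof. by rewrite -colE [LHS]mx11_scalar mxE. Qed.

Lemma row_col k l : k != l -> 'row_k *m 'col_l = 0 :> 'M[R]_1.
Proof. by move=> kl; rewrite row_mul mxE (negPf kl) raddf0. Qed.

(** For P = u e_k and Q = e_k v one has PQ = uv and QP = 0, whence XY = (e + uv) YX. *)
Lemma unipotent_commutator k u v : u k 0 = 0 -> v 0 k = 0 -> v *m u = 0 ->
  unipotent u v = commutator (unipotent u 'row_k) (unipotent 'col_k v).
Proof.
move=> uk vk vu; have ru : 'row_k *m u = 0 by rewrite row_mul uk raddf0.
have vc : v *m 'col_k = 0 by rewrite mul_col vk raddf0.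
set X := unipotent u 'row_k; set Y := unipotent 'col_k v.
apply: (mulIg (Y * X)%g); apply: (@etrans _ _ (X * Y)%g); last by group_simp.
apply: GL_mx_inj; rewrite !GL_mxM !unipotentE //.
have PQ : u *m 'row_k *m ('col_k *m v) = u *m v.
  by rewrite mulmxA -(mulmxA u) row_mul mxE !eqxx mulmx1.
have QP : 'col_k *m v *m (u *m 'row_k) = 0.
  by rewrite mulmxA -(mulmxA _ v) vu mulmx0 mul0mx.
have UQ : u *m v *m ('col_k *m v) = 0 by rewrite mulmxA -(mulmxA u) vc mulmx0 mul0mx.
have UP : u *m v *m (u *m 'row_k) = 0 by rewrite mulmxA -(mulmxA u) vu mulmx0 mul0mx.
rewrite !(mulmxDl, mulmxDr, mul1mx, mulmx1) PQ QP UQ UP mulmx0 !addr0 !addrA.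
by congr (_ + _); rewrite addrAC.
Qed.

End Unipotents.

Section Elementary.
Variables (n : nat) (R : pzRingType).
Local Notation "'col_ i" := (delta_mx i 0 : 'cV[R]_n) (at level 8, i at level 2).
Local Notation "'row_ i" := (delta_mx 0 i : 'rV[R]_n) (at level 8, i at level 2).
Implicit Types (g : GL n R) (u : 'cV[R]_n) (v : 'rV[R]_n) (c : R) (i j k l : 'I_n).
Local Notation ER := (elementary_subgroup n [set: R]).

Lemma colZE u c i : (u *m (c%:M : 'M_1)) i 0 = u i 0 * c.
Proof. by rewrite mxE big_ord1 mxE eqxx. Qed.

Lemma transvectionE i j c (ij : i != j) :
  transvection c ij = unipotent ('col_i *m (c%:M : 'M_1)) 'row_j.
Proof.
have rc : 'row_j *m ('col_i *m (c%:M : 'M_1)) = 0.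
  by rewrite mulmxA row_mul mxE [j == i]eq_sym (negPf ij) raddf0 mul0mx.
apply: GL_mx_inj; rewrite unipotentE // /GL_mx /= /transvection_mx.
congr (_ + _); rewrite -mulmxA mul_scalar_mx.
apply/matrixP => a b; rewrite !mxE big_ord1 !mxE eqxx andbT /=.
by case: (a == i); rewrite ?(mul1r, mul0r, mulr0).
Qed.

Lemma transvectionE_row i j c (ij : i != j) :
  transvection c ij = unipotent 'col_i (c *: 'row_j).
Proof. by rewrite transvectionE; apply: unipotent_prod; rewrite -mulmxA mul_scalar_mx. Qed.

Lemma transvectionV i j c (ij : i != j) :
  ((transvection c ij)^-1)%g = transvection (- c) ij.
Proof.
apply: GL_mx_inj; rewrite /GL_mx /=; exact: erefl.
Qed.

Lemma transvectionD i j c d (ij : i != j) :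
  transvection (c + d) ij = (transvection c ij * transvection d ij)%g.
Proof.
have rc e : (e *: 'row_j) *m 'col_i = 0.
  by rewrite mul_col !mxE (negPf ij) andbF mulr0 raddf0.
by rewrite !transvectionE_row scalerDl unipotentDr.
Qed.

Lemma transvection0 i j (ij : i != j) : transvection (0 : R) ij = 1%g.
Proof. by rewrite transvectionE raddf0 mulmx0 unipotent0. Qed.

(** For fixed v, the map from u to e + uv is a homomorphism on the columns killed by v; the
    induction carries vu = 0 along. *)
Lemma unipotent_sum (P : set (GL n R)) m (F : 'I_m -> 'cV[R]_n) v :
  subgroup P -> (forall q, v *m F q = 0) -> (forall q, P (unipotent (F q) v)) ->
  P (unipotent (\sum_q F q) v).
Proof.
move=> sP vF PF; pose Q u := v *m u = 0 /\ P (unipotent u v).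
suff [] : Q (\sum_q F q) by [].
apply: big_ind => [|u w [vu Pu] [vw Pw]|q _]; rewrite /Q.
- by rewrite mulmx0 unipotent0; split=> //; apply: subgroup1.
- by rewrite mulmxDr vu vw addr0 unipotentDl //; split=> //; apply: subgroupM.
- by split.
Qed.

Lemma unipotent_sum_row (P : set (GL n R)) m (p : pred 'I_m) u (F : 'I_m -> 'rV[R]_n) :
  subgroup P -> (forall q, p q -> F q *m u = 0) ->
  (forall q, p q -> P (unipotent u (F q))) -> P (unipotent u (\sum_(q | p q) F q)).
Proof.
move=> sP vF PF; pose Q v := v *m u = 0 /\ P (unipotent u v).
suff [] : Q (\sum_(q | p q) F q) by [].
apply: big_ind => [|v w [vu Pu] [vw Pw]|q pq]; rewrite /Q.
- rewrite mul0mx; split=> //; rewrite (@unipotent_prod _ _ _ _ 0 0) ?mulmx0 //.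
  by rewrite unipotent0; apply: subgroup1.
- by rewrite mulmxDl vu vw addr0 unipotentDr //; split=> //; apply: subgroupM.
- by split; [apply: vF|apply: PF].
Qed.

Lemma col_sum_delta u : u = \sum_q 'col_q *m ((u q 0)%:M : 'M_1).
Proof.
apply/matrixP => i j; rewrite (ord1 j) summxE (bigD1 i) //= colZE mxE !eqxx mul1r.
rewrite big1 ?addr0 // => q qi.
by rewrite colZE mxE [i == q]eq_sym (negPf qi) mul0r.
Qed.

Lemma elementary_col (I : set R) u k : (forall i, I (u i 0)) -> u k 0 = 0 ->
  elementary_subgroup n I (unipotent u 'row_k).
Proof.
move=> Iu uk; rewrite [u]col_sum_delta.
have Fq q : 'row_k *m ('col_q *m ((u q 0)%:M : 'M_1)) = 0.
  rewrite mulmxA row_mul mxE; have [<-|kq] := eqVneq k q; last by rewrite raddf0 mul0mx.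
  by rewrite uk raddf0 mulmx0.
apply: unipotent_sum => // [|q]; first exact: generated_subgroup.
have [->|qk] := eqVneq q k.
  by rewrite uk raddf0 mulmx0 unipotent0; apply: subgroup1; apply: generated_subgroup.
by rewrite -(transvectionE _ qk); apply: mem_generated; exists q, k, qk, (u q 0).
Qed.

Lemma elementary_row (I : set R) v k : (forall i, I (v 0 i)) -> v 0 k = 0 ->
  elementary_subgroup n I (unipotent 'col_k v).
Proof.
move=> Iv vk; rewrite [v]row_sum_delta.
have Fq q : (v 0 q *: 'row_q) *m 'col_k = 0.
  rewrite mul_col !mxE; have [->|kq] := eqVneq q k; first by rewrite vk mul0r raddf0.
  by rewrite andbF mulr0 raddf0.
apply: unipotent_sum_row => // [|q _]; first exact: generated_subgroup.
have [->|kq] := eqVneq q k.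
  rewrite vk (@unipotent_prod _ _ _ _ 0 0) ?scale0r ?mulmx0 //.
  by rewrite unipotent0; apply: subgroup1; apply: generated_subgroup.
have {}kq : k != q by rewrite eq_sym.
by rewrite -(transvectionE_row _ kq); apply: mem_generated; exists k, q, kq, (v 0 q).
Qed.

(* These are the conjugates of unipotents of level I in column l by unipotents in row l. *)
Definition root_set (I : set R) (l : 'I_n) : set (GL n R) :=
  [set g | exists u v, [/\ forall i, I (u i 0), v *m u = 0, v 0 l = 1
                         & g = unipotent u v]].

Definition relative_elementary (I : set R) : set (GL n R) :=
  generated (\bigcup_l root_set I l).

Local Notation K := relative_elementary.

Lemma relative_elementary_subgroup I : subgroup (K I).
Proof. exact: generated_subgroup. Qed.

Lemma sub_elementary (I J : set R) : I `<=` J ->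
  elementary_subgroup n I `<=` elementary_subgroup n J.
Proof.
move=> IJ; apply: generated_sub => [|g [i [j [ij [a [Ia ->]]]]]].
  exact: generated_subgroup.
by apply: mem_generated; exists i, j, ij, a; split=> //; apply: IJ.
Qed.

Hypothesis n3 : (3 <= n)%N.

(** Every use of n >= 3 goes through this choice. *)
Lemma third_index (i j : 'I_n) : exists k : 'I_n, k != i /\ k != j.
Proof.
have /existsP[k] : [exists k, k \notin [set i; j]%SET].
  rewrite -negb_forall; apply/negP => /forallP H.
  have : (#|'I_n| <= #|[set i; j]%SET|)%N.
    by apply/subset_leq_card/fintype.subsetP => k _; apply: H.
  by rewrite card_ord cards2; case: (i == j) => /= /(leq_trans n3).
by rewrite !inE negb_or => /andP[]; exists k.
Qed.

(** * Root elements over an ideal *)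

Section Ideal.
Variable I : set R.
Hypothesis idI : two_sided_ideal I.

Definition mx_in p q (M : 'M[R]_(p, q)) := forall (i : 'I_p) (j : 'I_q), I (M i j).

Lemma mx_in0 p q : @mx_in p q 0.
Proof. by move=> i j; rewrite mxE; apply: ideal_zero. Qed.

Lemma mx_inD p q (M N : 'M[R]_(p, q)) : mx_in M -> mx_in N -> mx_in (M + N).
Proof. by move=> IM IN i j; rewrite mxE; apply: ideal_add. Qed.

Lemma mx_inN p q (M : 'M[R]_(p, q)) : mx_in M -> mx_in (- M).
Proof. by move=> IM i j; rewrite mxE; apply: ideal_opp. Qed.

Lemma mx_in_mull p q r (M : 'M[R]_(p, q)) (N : 'M[R]_(q, r)) :
  mx_in N -> mx_in (M *m N).
Proof. by move=> IN i j; rewrite mxE; apply: ideal_sum => // k _; apply: ideal_mull. Qed.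

Lemma mx_in_mulr p q r (M : 'M[R]_(p, q)) (N : 'M[R]_(q, r)) :
  mx_in M -> mx_in (M *m N).
Proof. by move=> IN i j; rewrite mxE; apply: ideal_sum => // k _; apply: ideal_mulr. Qed.

Lemma mx_in_colP u : mx_in u <-> forall i, I (u i 0).
Proof. by split=> Iu i; [apply: Iu|move=> j; rewrite (ord1 j)]. Qed.

Lemma mem_root_set l u v : mx_in u -> v *m u = 0 -> v 0 l = 1 ->
  root_set I l (unipotent u v).
Proof. by move=> /mx_in_colP Iu vu vl; exists u, v. Qed.

(* If u_k = 0, the k-th entry of v can be adjusted to 1. *)
Lemma root_set_split k u v : mx_in u -> v *m u = 0 -> u k 0 = 0 ->
  generated (root_set I k) (unipotent u v).
Proof.
move=> Iu vu uk; pose c := v 0 k - 1.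
have rc : (c *: 'row_k) *m u = 0 by rewrite -scalemxAl row_mul uk raddf0 scaler0.
have vrc : (v - c *: 'row_k) *m u = 0 by rewrite mulmxBl vu rc subr0.
rewrite -[v](subrK (c *: 'row_k)) unipotentDr //.
apply: (subgroupM (generated_subgroup _)); apply: mem_generated.
  apply: mem_root_set => //; rewrite !mxE !eqxx mulr1 /c opprB addrCA subrr addr0 //.
rewrite (@unipotent_prod _ _ _ _ (u *m (c%:M : 'M_1)) 'row_k).
  apply: mem_root_set; [exact: mx_in_mulr| |by rewrite mxE !eqxx].
  by rewrite mulmxA row_mul uk raddf0 mul0mx.
by rewrite -mulmxA mul_scalar_mx.
Qed.

(** For v_l = 1 these columns span the kernel of v, and each vanishes outside the two indices q and
    l. *)
Definition annihilated_col l v q : 'cV[R]_n := 'col_q - 'col_l *m ((v 0 q)%:M : 'M_1).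

Lemma mul_annihilated_col l v q : v 0 l = 1 -> v *m annihilated_col l v q = 0.
Proof.
by move=> vl; rewrite mulmxBr mulmxA !mul_col vl mul1mx subrr.
Qed.

Lemma annihilated_col_entry l v q k : k != q -> k != l -> annihilated_col l v q k 0 = 0.
Proof.
move=> kq kl; rewrite mxE mxE [X in _ + X]mxE colZE !mxE.
by rewrite (negPf kq) (negPf kl) mul0r subr0.
Qed.

Lemma annihilated_col_sum l u v : v *m u = 0 ->
  u = \sum_q annihilated_col l v q *m ((u q 0)%:M : 'M_1).
Proof.
move=> vu; under eq_bigr do rewrite mulmxBl -mulmxA -scalar_mxM.
rewrite sumrB -col_sum_delta -mulmx_sumr -(raddf_sum (@scalar_mx R 1)).
suff -> : \sum_q v 0 q * u q 0 = 0 by rewrite raddf0 mulmx0 subr0.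
by move/matrixP/(_ 0 0): vu; rewrite !mxE.
Qed.

(** Allows a prescribed index j to be avoided. If l = j, then u splits along the [annihilated_col]s,
    each of which vanishes at some k other than j. *)
Lemma root_set_other l j : root_set I l `<=`
  generated (\bigcup_(k in [set k | k != j]) root_set I k).
Proof.
move=> _ [u [v [/mx_in_colP Iu vu vl ->]]].
have [lj|lj] := eqVneq l j; last first.
  by apply: mem_generated; exists l => //; apply: mem_root_set.
rewrite [u](annihilated_col_sum l vu).
have va q : v *m (annihilated_col l v q *m ((u q 0)%:M : 'M_1)) = 0.
  by rewrite mulmxA mul_annihilated_col // mul0mx.
apply: unipotent_sum => // [|q]; first exact: generated_subgroup.
have [k [kq kl]] := third_index q l.
apply: (@generated_sub _ (root_set I k)).
- exact: generated_subgroup.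
- by move=> g kg; apply: mem_generated; exists k => //=; rewrite -lj.
apply: root_set_split => //; last by rewrite colZE annihilated_col_entry ?mul0r.
apply: mx_in_mull => a b; rewrite (ord1 a) (ord1 b) mxE eqxx mulr1n.
exact: Iu.
Qed.

Lemma elementary_sub_relative : elementary_subgroup n I `<=` K I.
Proof.
apply: generated_sub => [|g [i [j [ij [a [Ia ->]]]]]]; first exact: generated_subgroup.
apply: mem_generated; exists j => //; rewrite transvectionE.
apply: mem_root_set; rewrite ?mxE ?eqxx //.
  by apply/mx_in_colP => k; rewrite colZE; apply: ideal_mull.
by rewrite mulmxA row_mul mxE [j == i]eq_sym (negPf ij) raddf0 mul0mx.
Qed.

Lemma relative_elementary_normalized : normalizes ER (K I).
Proof.
have sK := relative_elementary_subgroup I.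
have H t : (exists i j (ij : i != j) c, t = transvection c ij) ->
    forall g, K I g -> K I (t * g * t^-1)%g.
  move=> [p [r [pr [c Et]]]] g Kg.
  suff : K I `<=` [set g | K I (t * g * t^-1)%g] by apply.
  have sub : subgroup [set g | K I (t * g * t^-1)%g].
    apply: subgroupI => [|x y Kx Ky|x Kx] /=.
    - by rewrite mulg1 mulgV; apply: subgroup1.
    - have -> : (t * (x * y) * t^-1 = t * x * t^-1 * (t * y * t^-1))%g by group_simp.
      exact: (subgroupM sK).
    - have -> : (t * x^-1 * t^-1 = (t * x * t^-1)^-1)%g by group_simp.
      exact: (subgroupV sK).
  (* Conjugation by t_pr(c) changes v only in entry r, so v_k = 1 persists for generators with k !=
     r. *)
  apply: generated_sub => // h [l _ /(@root_set_other l r)].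
  apply: generated_sub => // {h} _ [k kr [u [v [/mx_in_colP Iu vu vk ->]]]] /=.
  rewrite unipotentJ //; apply: mem_generated; exists k => //.
  apply: mem_root_set; first exact: mx_in_mull.
    by rewrite mulmxA -(mulmxA v) GL_mxV mulmx1.
  rewrite Et transvectionV transvectionE_row unipotentE.
    rewrite mulmxDr mulmx1 mulmxA mul_col mul_scalar_mx !mxE /= vk.
    by rewrite (negPf kr) !mulr0 addr0.
  by rewrite -scalemxAl row_mul mxE [r == p]eq_sym (negPf pr) raddf0 scaler0.
apply: normalizes_generated => // _ h [i [j [ij [c [_ ->]]]]] Kh; split.
  by apply: H => //; exists i, j, ij, c.
rewrite -[X in (_ * X)%g]invgK transvectionV; apply: H => //.
by exists i, j, ij, (- c).
Qed.

(** * Congruence subgroups and their commutators with E(n,R) *)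

Local Notation congr := (principal_congruence_subgroup n I).

Lemma congrP g : congr g <-> mx_in (GL_mx g - 1%:M).
Proof.
rewrite /principal_congruence_subgroup /=; split=> [gI i j|gI].
  have : coset I (GL_mx g i j) (GL_mx g i j).
    by rewrite /coset /= subrr; apply: ideal_zero.
  by move/matrixP/(_ i j): gI; rewrite !mxE => -> .
apply/matrixP => i j; have := gI i j; rewrite !mxE => Ig.
set c := GL_mx g i j in Ig *; set d := _ *+ _ in Ig *.
apply/seteqP; split=> x; rewrite /coset /= => Ix.
  have -> : x - d = (x - c) + (c - d) by ncring.
  by apply: ideal_add.
have -> : x - c = (x - d) - (c - d) by ncring.
by apply: ideal_sub.
Qed.

Lemma congr_subgroup : subgroup congr.
Proof.
apply: subgroupI => [|x y /congrP Ix /congrP Iy|x /congrP Ix]; apply/congrP.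
- by rewrite GL_mx1 subrr; apply: mx_in0.
- have -> : GL_mx (x * y)%g - 1%:M = (GL_mx x - 1%:M) *m GL_mx y + (GL_mx y - 1%:M).
    by rewrite mulmxBl mul1mx addrA subrK.
  by apply: mx_inD => //; apply: mx_in_mulr.
- have -> : GL_mx x^-1%g - 1%:M = - (GL_mx x^-1%g *m (GL_mx x - 1%:M)).
    by rewrite mulmxBr mulmx1 GL_mxV opprB.
  by apply: mx_inN; apply: mx_in_mull.
Qed.

Lemma elementary_congr : elementary_subgroup n I `<=` congr.
Proof.
apply: generated_sub => [|_ [i [j [ij [a [Ia ->]]]]]]; first exact: congr_subgroup.
apply/congrP; rewrite /GL_mx /= /transvection_mx addrAC subrr add0r => p q.
by rewrite mxE; apply: ideal_mulr.
Qed.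

(** Since v kills e_l, the part e_l u_l of u splits off as a row unipotent; the rest has entry l
    zero and falls under [root_set_split]. *)
Lemma sub_relative_elementary u v l : mx_in u -> v *m u = 0 -> v 0 l = 0 ->
  relative_elementary I (unipotent u v).
Proof.
move=> Iu vu vl; have sK := relative_elementary_subgroup I.
pose w := u - 'col_l *m ((u l 0)%:M : 'M_1).
have vlc : v *m ('col_l *m ((u l 0)%:M : 'M_1)) = 0.
  by rewrite mulmxA mul_col vl raddf0 mul0mx.
have vw : v *m w = 0 by rewrite mulmxBr vu vlc subr0.
rewrite -[u](subrK ('col_l *m ((u l 0)%:M : 'M_1))) unipotentDl //.
apply: (subgroupM sK).
  apply: (@generated_sub _ (root_set I l)) => //.
    by move=> h Ih; apply: mem_generated; exists l.
  apply: root_set_split => //.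
    apply: mx_inD => //; apply: mx_inN; apply: mx_in_mull => a b.
    by rewrite (ord1 a) (ord1 b) mxE eqxx; apply: Iu.
  by rewrite mxE [X in _ + X]mxE colZE mxE !eqxx mul1r subrr.
apply: elementary_sub_relative.
rewrite (@unipotent_prod _ _ _ _ 'col_l (u l 0 *: v)); last first.
  by rewrite -mulmxA mul_scalar_mx.
apply: elementary_row; last by rewrite mxE vl mulr0.
by move=> i; rewrite mxE; apply: ideal_mulr => //; apply: Iu.
Qed.

Lemma transvection_commutator i k j c d (ik : i != k) (kj : k != j) (ij : i != j) :
  transvection (c * d) ij = commutator (transvection c ik) (transvection d kj).
Proof.
rewrite (transvectionE c ik) (transvectionE_row d kj) -unipotent_commutator.
- rewrite transvectionE; apply: unipotent_prod.
  by rewrite scalar_mxM -!mulmxA (mul_scalar_mx d).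
- by rewrite colZE mxE [k == i]eq_sym (negPf ik) mul0r.
- by rewrite !mxE (negPf kj) andbF mulr0.
- by rewrite -scalemxAl mulmxA row_mul mxE [j == i]eq_sym (negPf ij) raddf0 mul0mx scaler0.
Qed.

(* The rows w_k = s e_k - u_k y e_i annihilate the column u, and s v = sum_k v_k w_k. *)
Lemma commutator_invertible_entry g i j (ij : i != j) (s y r : R) : congr g ->
    (forall k, s * GL_mx g k i = GL_mx g k i * s) ->
    (forall k, s * GL_mx g^-1%g j k = GL_mx g^-1%g j k * s) ->
    GL_mx g i i * y = s -> y * GL_mx g i i = s ->
  relative_elementary I (commutator g (transvection (r * s) ij)).
Proof.
move=> Ig; set u := GL_mx g *m 'col_i; set v := 'row_j *m GL_mx g^-1%g.
have uE k : GL_mx g k i = u k 0 by rewrite /u -colE mxE.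
have vE k : GL_mx g^-1%g j k = v 0 k by rewrite /v -rowE mxE.
rewrite uE => su sv uy yu.
have {}su k : s * u k 0 = u k 0 * s by rewrite -uE su.
have {}sv k : s * v 0 k = v 0 k * s by rewrite -vE sv.
have vu : v *m u = 0.
  rewrite /u /v mulmxA -(mulmxA 'row_j) GL_mxV mulmx1 mul_col mxE.
  by rewrite (negPf ij) andbF raddf0.
have sK := relative_elementary_subgroup I.
have sE := generated_subgroup.
have KN := relative_elementary_normalized.
have sub1E (M : 'M[R]_n) a b : (M - 1%:M) a b = M a b - (a == b)%:R.
  by rewrite !mxE.
have Iu k : k != i -> I (u k 0).
  move=> ki; have /congrP/(_ k i) := Ig.
  by rewrite sub1E uE (negPf ki) subr0.
have Iui : I (u i 0 - 1).
  have /congrP/(_ i i) := Ig.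
  by rewrite sub1E uE eqxx.
have IgV := subgroupV congr_subgroup Ig.
have Iv k : k != j -> I (v 0 k).
  move=> kj; have /congrP/(_ j k) := IgV.
  by rewrite sub1E vE eq_sym (negPf kj) subr0.
have Ivj : I (v 0 j - 1).
  have /congrP/(_ j j) := IgV.
  by rewrite sub1E vE eqxx.
pose w k : 'rV[R]_n := s *: 'row_k - (u k 0 * y) *: 'row_i.
have wu k : w k *m u = 0.
  rewrite mulmxBl -!scalemxAl !row_mul -!mul_scalar_mx -!scalar_mxM -mulrA yu su.
  by rewrite subrr.
have svE : s *: v = \sum_k v 0 k *: w k.
  have wE k : v 0 k *: w k = s *: (v 0 k *: 'row_k) - (v 0 k * u k 0) *: (y *: 'row_i).
    by rewrite scalerBr !scalerA sv mulrA.
  under eq_bigr do rewrite wE.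
  rewrite sumrB -scaler_sumr -scaler_suml -row_sum_delta.
  suff -> : \sum_k v 0 k * u k 0 = 0 by rewrite scale0r subr0.
  by move/matrixP/(_ 0 0): vu; rewrite [LHS]mxE [RHS]mxE.
pose ur := u *m (r%:M : 'M_1).
have wur k : w k *m ur = 0 by rewrite mulmxA wu mul0mx.
have gtg : (g * transvection (r * s) ij * g^-1)%g = unipotent ur (s *: v).
  rewrite transvectionE unipotentJ; last first.
    by rewrite mulmxA row_mul mxE [j == i]eq_sym (negPf ij) raddf0 mul0mx.
  by apply: unipotent_prod; rewrite scalar_mxM -(mul_scalar_mx s v) /ur /u /v !mulmxA.
have gen k : unipotent ur (v 0 k *: w k) = unipotent (u *m ((r * v 0 k)%:M : 'M_1)) (w k).
  by apply: unipotent_prod; rewrite scalar_mxM -(mul_scalar_mx (v 0 k)) /ur !mulmxA.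
have vwur k : (v 0 k *: w k) *m ur = 0 by rewrite -scalemxAl wur scaler0.
(* The factors with k != j lie in K(I) because v_k is in I; the factor k = j is to be matched with
   t_ij(rs). *)
rewrite /commutator gtg svE (bigD1 j) //= addrC unipotentDr //; last first.
  by rewrite mulmx_suml big1 // => k _; apply: vwur.
rewrite -mulgA; apply: (subgroupM sK).
  apply: unipotent_sum_row => // k kj; rewrite gen.
  have [l [lk li]] := third_index k i.
  apply: (@sub_relative_elementary _ _ l).
  - apply: mx_in_mull => a b; rewrite (ord1 a) (ord1 b) mxE eqxx mulr1n.
    by apply: ideal_mull => //; apply: Iv.
  - by rewrite mulmxA wu mul0mx.
  - by rewrite !mxE (negPf lk) (negPf li) !andbF !mulr0 subr0.
rewrite gen; set c := r * v 0 j.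
have [l [li lj]] := third_index i j.
have il : i != l by rewrite eq_sym.
have ulw : w j *m ('col_l *m ((u l 0)%:M : 'M_1)) = 0.
  by rewrite mulmxA mul_col !mxE (negPf li) (negPf lj) !andbF !mulr0 subr0 raddf0 mul0mx.
have subcolE (x : 'cV[R]_n) a k b : (x - 'col_k *m (a%:M : 'M_1)) b 0 = x b 0 - (b == k)%:R * a.
  by rewrite mxE [X in _ + X]mxE colZE mxE andbT.
(* Clearing entry l of u costs only a row unipotent of level I, as u_l is in I. *)
pose u' := u - 'col_l *m ((u l 0)%:M : 'M_1).
have u'l : u' l 0 = 0 by rewrite subcolE eqxx mul1r subrr.
have u'E k : k != l -> u' k 0 = u k 0.
  by move=> kl; rewrite subcolE (negPf kl) mul0r subr0.
have wu' : w j *m u' = 0 by rewrite mulmxBr wu ulw subr0.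
have wl : w j 0 l = 0 by rewrite !mxE (negPf li) (negPf lj) !andbF !mulr0 subr0.
have -> : u *m (c%:M : 'M_1) =
    u' *m (c%:M : 'M_1) + 'col_l *m ((u l 0)%:M : 'M_1) *m (c%:M : 'M_1).
  by rewrite -mulmxDl subrK.
rewrite unipotentDl; try by rewrite mulmxA ?wu' ?ulw mul0mx.
set t := transvection (r * s) ij; set tau := unipotent _ _; set kap := unipotent _ _.
have Kkap : relative_elementary I kap.
  rewrite /kap (@unipotent_prod _ _ _ _ 'col_l ((u l 0 * c) *: w j)); last first.
    by rewrite -scalerA -!mulmxA !mul_scalar_mx.
  apply: elementary_sub_relative; apply: elementary_row; last by rewrite mxE wl mulr0.
  by move=> k; rewrite mxE; do 2!apply: ideal_mulr => //; apply: Iu.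
have Et i' j' c' (ij' : i' != j') : ER (transvection c' ij').
  by apply: mem_generated; exists i', j', ij', c'.
have -> : (tau * kap * t^-1 = tau * t^-1 * (t * kap * t^-1))%g by group_simp.
apply: (subgroupM sK); last by apply: KN => //; apply: Et.
have lj' : l != j by [].
(* Both t and tau become commutators through the index l. Their arguments agree modulo I: u'c with
   e_i r, and w_j with s e_j. *)
rewrite /t (transvection_commutator r s il lj' ij) /tau.
rewrite (@unipotent_commutator _ _ l); last 3 first.
- by rewrite colZE u'l mul0r.
- by [].
- by rewrite mulmxA wu' mul0mx.
have -> : unipotent (u' *m (c%:M : 'M_1)) 'row_l =
    (unipotent (u' *m (c%:M : 'M_1) - 'col_i *m (r%:M : 'M_1)) 'row_l
     * transvection r il)%g.
  rewrite transvectionE -unipotentDl ?subrK //.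
    rewrite mulmxBr !mulmxA !row_mul u'l mxE (negPf li) !raddf0 !mul0mx subrr //.
  by rewrite mulmxA row_mul mxE (negPf li) raddf0 mul0mx.
have -> : unipotent 'col_l (w j) =
    (unipotent 'col_l (- (u j 0 * y) *: 'row_i) * transvection s lj')%g.
  rewrite transvectionE_row -unipotentDr.
  - by rewrite /w scaleNr addrC.
  - by rewrite -scalemxAl row_col // scaler0.
  - by rewrite -scalemxAl row_col ?scaler0 // eq_sym.
apply: (commutator_cong (sE _ _) sK KN _ _ (Et _ _ _ _) (Et _ _ _ _));
  apply: elementary_sub_relative.
- apply: elementary_col; last by rewrite subcolE colZE u'l (negPf li) !mul0r subrr.
  move=> k; rewrite subcolE colZE; have [->|ki] := eqVneq k i.
    rewrite u'E // mul1r.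
    have -> : u i 0 * c - r = (u i 0 - 1) * c + r * (v 0 j - 1).
      by rewrite /c; move: (u i 0) (v 0 j) => a b; ncring.
    by apply: ideal_add => //; [apply: ideal_mulr => //|apply: ideal_mull => //].
  rewrite mul0r subr0; apply: ideal_mulr => //.
  by have [->|kl] := eqVneq k l; [rewrite u'l; apply: ideal_zero|rewrite u'E //; apply: Iu].
- apply: elementary_row; last by rewrite !mxE (negPf li) andbF mulr0.
  move=> k; rewrite mxE; apply: ideal_mulr => //; apply: ideal_opp => //.
  by apply: ideal_mulr => //; apply: Iu; rewrite eq_sym.
Qed.

(* The c such that [g, t_ij(rc)] is in K for all r form an ideal of the centre of S;
   it contains every s reached by making the entry (i, i) of g invertible up to s. *)
Lemma commutator_module_finite (S : set R) g i j (ij : i != j) (r : R) :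
    GRing.subring_closed (mem S) -> module_finite S -> congr g ->
    (forall k l, S (GL_mx g k l)) -> (forall k l, S (GL_mx g^-1%g k l)) ->
  relative_elementary I (commutator g (transvection r ij)).
Proof.
move=> ringS finS Ig Sg SgV; have [/set_mem S1 SB' SM'] := ringS.
have SB x y : S x -> S y -> S (x - y).
  by move=> Sx Sy; apply/set_mem/SB'; apply: mem_set.
have SM x y : S x -> S y -> S (x * y).
  by move=> Sx Sy; apply/set_mem/SM'; apply: mem_set.
have S0 : S 0 by rewrite -(subrr 1); apply: SB.
have SN x : S x -> S (- x) by rewrite -sub0r; apply: SB.
have SD x y : S x -> S y -> S (x + y) by move=> Sx /SN Sy; rewrite -[y]opprK; apply: SB.
have Ssum (p : pred 'I_n) (F : 'I_n -> R) :
    (forall k, p k -> S (F k)) -> S (\sum_(k | p k) F k) by move=> SF; apply: big_ind.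
have sK := relative_elementary_subgroup I; have KN := relative_elementary_normalized.
have Et c : ER (transvection c ij) by apply: mem_generated; exists i, j, ij, c.
pose u k := GL_mx g k i; pose a k := GL_mx g^-1%g i k.
have Iu : I (1 - u i).
  have /congrP/(_ i i) := Ig; rewrite !mxE eqxx -opprB => Iui.
  by rewrite -[_ - _]opprK; apply: ideal_opp.
have au : \sum_k a k * u k = 1.
  by have /matrixP/(_ i i) := GL_mxV g; rewrite !mxE eqxx.
have S1u : S (1 - u i) by apply: SB => //; apply: Sg.
(* Letting r range over all of R makes X stable under multiplication by the centre of S. *)
pose X c := centre S c /\
  forall r, relative_elementary I (commutator g (transvection (r * c) ij)).
suff [_ /(_ r)] : X 1 by rewrite mulr1.
(* The relation is u_i + (1 - u_i) sum_k a_k u_k = 1; the factor 1 - u_i, which is in I, keeps the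
   correction at level I. *)
apply: (@stable_rank1_cover _ S ringS X (1 + (1 - u i) * a i) (u i)
  (\sum_(k | k != i) (1 - u i) * a k * u k)) => //.
- split=> [c []|||] //.
  + split=> [|q]; last by rewrite mulr0 transvection0; group_simp; apply: (subgroup1 sK).
    by split=> // s _; rewrite mul0r mulr0.
  + move=> c d [[Sc cC] Kc] [[Sd dC] Kd]; split=> [|q].
      by split=> [|s Ss]; [apply: SB|rewrite mulrBl mulrBr cC // dC].
    rewrite mulrBr -mulNr transvectionD.
    set x := transvection (q * c) ij; set y := transvection _ ij.
    have -> : commutator g (x * y)%g = (commutator g x * (x * commutator g y * x^-1))%g.
      by group_simp.
    by apply: (subgroupM sK); [apply: Kc|apply: KN; [apply: Et|apply: Kd]].
  + move=> c d [Sc cC] [[Sd dC] Kd]; split=> [|q]; last by rewrite mulrA.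
    split=> [|s Ss]; first exact: SM.
    by rewrite -mulrA dC // mulrA cC // -mulrA.
- by apply: SD => //; apply: SM => //; apply: SgV.
- exact: Sg.
- by apply: Ssum => k _; apply: (SM); [apply: (SM) => //; apply: SgV|apply: Sg].
- have : \sum_k (1 - u i) * a k * u k = 1 - u i.
    by under eq_bigr do rewrite -mulrA; rewrite -mulr_sumr au mulr1.
  by rewrite (bigD1 i) //= => uE; rewrite mulrDl mul1r -addrA uE addrC subrK.
move=> c y s Sc Sy [Ss sC] E1 E2; split=> // q.
(* Left multiplication of g by e + e_i d adds exactly the correction from stable rank 1 to the entry
   u_i. *)
pose d : 'rV[R]_n := \row_k (if k == i then 0 else c * ((1 - u i) * a k)).
have di : d 0 i = 0 by rewrite mxE eqxx.
have Sd k : S (d 0 k).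
  rewrite mxE; case: eqP => // _; apply: (SM) => //; apply: (SM) => //.
  exact: SgV.
have Id k : I (d 0 k).
  rewrite mxE; case: eqP => _; first exact: ideal_zero.
  by apply: ideal_mull => //; apply: ideal_mulr => //.
have dc : d *m 'col_i = 0 by rewrite mul_col di raddf0.
pose e := unipotent 'col_i d.
have Ee : elementary_subgroup n I e by apply: elementary_row.
have Ke := elementary_sub_relative Ee.
pose t := transvection (q * s) ij.
have -> : (commutator g t = e^-1 * commutator (e * g) t * (t * e * t^-1))%g by group_simp.
apply: (subgroupM sK); last exact: KN (Et _) Ke.
apply: (subgroupM sK); first exact: (subgroupV sK).
have egE k : GL_mx (e * g)%g k i = u k + (k == i)%:R * \sum_l d 0 l * u l.
  rewrite GL_mxM unipotentE // mulmxDl mul1mx -mulmxA mxE; congr (_ + _).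
  by rewrite mxE big_ord1 !mxE andbT.
have egVE k : GL_mx (e * g)^-1%g j k = GL_mx g^-1%g j k - GL_mx g^-1%g j i * d 0 k.
  rewrite invgM GL_mxM unipotentV // unipotentE ?mulmxN ?dc ?oppr0 //.
  rewrite mulmxDr mulmx1 mulNmx mulmxN mulmxA -colE mxE; congr (_ + _).
  by rewrite mxE [in LHS]mxE big_ord1 [in LHS]mxE.
have dsum : \sum_l d 0 l * u l = c * \sum_(k | k != i) (1 - u i) * a k * u k.
  rewrite (bigD1 i) //= di mul0r add0r mulr_sumr; apply: eq_bigr => k ki.
  by rewrite mxE (negPf ki) -!mulrA.
have egii : GL_mx (e * g)%g i i = u i + c * \sum_(k | k != i) (1 - u i) * a k * u k.
  by rewrite egE eqxx mul1r dsum.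
apply: (@commutator_invertible_entry _ _ _ _ _ y).
- by apply: (subgroupM congr_subgroup) => //; apply: elementary_congr.
- move=> k; apply: sC; rewrite egE; apply: SD; [exact: Sg|case: (k == i)].
    by rewrite mulr1n mul1r; apply: Ssum => l _; apply: (SM) => //; apply: Sg.
  by rewrite mulr0n mul0r.
- by move=> k; apply: sC; rewrite egVE; apply: SB => //; apply: SM.
- by rewrite egii.
- by rewrite egii.
Qed.

(** The finitely many entries of g and its inverse lie in one module finite subring, which settles
    transvections; [commutator_preimage] extends this to E(n,R). *)
Lemma commutator_congr_elementary g e : quasi_finite R -> congr g -> ER e ->
  relative_elementary I (commutator g e).
Proof.
move=> [F [FS dirF covF]] Ig.
have fin (s : seq R) : exists2 S, F S & forall x, x \in s -> S x.
  elim: s => [|x s [S FS' sS]].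
    by have [S FS' _] : (\bigcup_(S in F) S) 0 by [rewrite covF]; exists S.
  have [T FT Tx] : (\bigcup_(S in F) S) x by rewrite covF.
  have [U [FU SU TU]] := dirF _ _ FS' FT; exists U => // z.
  by rewrite inE => /orP[/eqP ->|/sS zS]; [apply: TU|apply: SU].
have [S FS' Sg] := fin ([seq GL_mx g p.1 p.2 | p : 'I_n * 'I_n]
  ++ [seq GL_mx g^-1%g p.1 p.2 | p : 'I_n * 'I_n]).
have [ringS finS] := FS _ FS'.
have sP := commutator_preimage g (generated_subgroup _ : subgroup ER)
  (relative_elementary_subgroup I) relative_elementary_normalized.
move=> Ee; apply: (proj2 (generated_sub sP _ Ee)).
move=> _ [i [j [ij [c [_ ->]]]]]; split; first by apply: mem_generated; exists i, j, ij, c.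
apply: (commutator_module_finite _ _ ringS finS Ig) => k l; apply: Sg; rewrite mem_cat.
  apply/orP; left; rewrite -[GL_mx g k l]/((fun p => GL_mx g p.1 p.2) (k, l)).
  by rewrite map_f ?mem_enum.
apply/orP; right; rewrite -[GL_mx _ k l]/((fun p => GL_mx g^-1%g p.1 p.2) (k, l)).
by rewrite map_f ?mem_enum.
Qed.

End Ideal.
(** * Commutators of two levels *)

Section Mixed.
Variables A B : set R.
Hypotheses (idA : two_sided_ideal A) (idB : two_sided_ideal B).

(** The ideal AB + BA, as the least additive subgroup containing the products, so that membership is
    itself an induction principle. *)
Definition mixed_ideal : set R := [set x | forall P : set R, P 0 ->
  (forall x y, P x -> P y -> P (x - y)) ->
  (forall a b, A a -> B b -> P (a * b) /\ P (b * a)) -> P x].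

Local Notation J := mixed_ideal.

Lemma mixed_ideal_mul a b : A a -> B b -> J (a * b) /\ J (b * a).
Proof. by move=> Aa Bb; split=> P _ _ PM; have [] := PM a b Aa Bb. Qed.

Lemma mixed_ideal_two_sided : two_sided_ideal J.
Proof.
have J0 : J 0 by [].
have JB x y : J x -> J y -> J (x - y).
  by move=> Jx Jy P P0 PB PM; apply: (PB); [apply: Jx|apply: Jy].
split=> // r x Jx; apply: (Jx [set x | J (r * x) /\ J (x * r)]).
- by rewrite /= mulr0 mul0r.
- move=> y z [Jy Jy'] [Jz Jz']; rewrite /= mulrBr mulrBl.
  by split; apply: JB.
- move=> a b Aa Bb /=; rewrite !mulrA -!(mulrA _ _ r).
  split; split.
  + by have [] := mixed_ideal_mul (ideal_mull idA r Aa) Bb.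
  + by have [] := mixed_ideal_mul Aa (ideal_mulr idB r Bb).
  + by have [] := mixed_ideal_mul Aa (ideal_mull idB r Bb).
  + by have [] := mixed_ideal_mul (ideal_mulr idA r Aa) Bb.
Qed.

Let idJ := mixed_ideal_two_sided.

(** Follows from [x,y] - e = ((x - e)(y - e) - (y - e)(x - e)) x^-1 y^-1. *)
Lemma commutator_congr_mixed x y : principal_congruence_subgroup n A x ->
    principal_congruence_subgroup n B y ->
  principal_congruence_subgroup n J (commutator x y).
Proof.
move=> /(congrP idA) Ax /(congrP idB) By; apply/(congrP idJ).
have JM p q r (M : 'M[R]_(p, q)) (N : 'M[R]_(q, r)) :
    mx_in A M -> mx_in B N -> mx_in J (M *m N).
  move=> AM BN i' j'; rewrite mxE; apply: ideal_sum => // k' _.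
  by have [] := mixed_ideal_mul (AM i' k') (BN k' j').
have JM' p q r (M : 'M[R]_(p, q)) (N : 'M[R]_(q, r)) :
    mx_in B M -> mx_in A N -> mx_in J (M *m N).
  move=> AM BN i' j'; rewrite mxE; apply: ideal_sum => // k' _.
  by have [] := mixed_ideal_mul (BN k' j') (AM i' k').
set X := GL_mx x in Ax *; set Y := GL_mx y in By *.
have -> : GL_mx (commutator x y) - 1%:M =
    ((X - 1%:M) *m (Y - 1%:M) - (Y - 1%:M) *m (X - 1%:M)) *m GL_mx (x^-1 * y^-1)%g.
  have -> : (X - 1%:M) *m (Y - 1%:M) - (Y - 1%:M) *m (X - 1%:M) = X *m Y - Y *m X.
    rewrite !(mulmxBl, mulmxBr, mulmx1, mul1mx) !opprB !addrA.
    by rewrite [LHS](ACl (1*5*(2*7)*(3*6)*(4*8))) /=; ncring.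
  have -> : commutator x y = ((x * y) * (x^-1 * y^-1))%g by rewrite /commutator !mulgA.
  rewrite GL_mxM mulmxBl; congr (_ - _).
  rewrite -[Y *m X]/(GL_mx (y * x)%g) -GL_mxM.
  by have -> : (y * x * (x^-1 * y^-1) = 1)%g by group_simp.
by apply: mx_in_mulr => //; apply: mx_inD => //; [apply: JM|apply: mx_inN => //; apply: JM'].
Qed.

End Mixed.

(** * The subgroup [E(n,A), E(n,B)] *)

Section MixedCommutators.
Variables A B : set R.
Hypotheses (idA : two_sided_ideal A) (idB : two_sided_ideal B).
Local Notation J := (mixed_ideal A B).
Local Notation EA := (elementary_subgroup n A).
Local Notation EB := (elementary_subgroup n B).
Local Notation H := (commutator_subgroup EA EB).

Let sH : subgroup H. Proof. exact: generated_subgroup. Qed.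
Let sE (I : set R) : subgroup (elementary_subgroup n I). Proof. exact: generated_subgroup. Qed.
Let idJ := mixed_ideal_two_sided idA idB.

Let memH x y : EA x -> EB y -> H (commutator x y).
Proof. by move=> Ax By; apply: mem_generated; exists x => //; exists y. Qed.

Let memH' x y : EB x -> EA y -> H (commutator x y).
Proof. by move=> Bx Ay; rewrite -commutatorV; apply: (subgroupV sH); apply: memH. Qed.

Let Et (I : set R) i j c (ij : i != j) : I c -> elementary_subgroup n I (transvection c ij).
Proof. by move=> Ic; apply: mem_generated; exists i, j, ij, c. Qed.

Lemma elementary_mixed : elementary_subgroup n J `<=` H.
Proof.
apply: generated_sub => // _ [i [j [ij [c [Jc ->]]]]].
apply: (Jc [set c | H (transvection c ij)]) => /=.
- by rewrite transvection0; apply: (subgroup1 sH).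
- move=> x y Hx Hy; rewrite transvectionD -transvectionV.
  by apply: (subgroupM sH) => //; apply: (subgroupV sH).
move=> a b Aa Bb; have [k [ki kj]] := third_index i j.
have ik : i != k by rewrite eq_sym.
rewrite !(transvection_commutator _ _ ik kj ij).
by split; [apply: memH|apply: memH']; apply: Et.
Qed.

(** Once entry k of v is removed, [unipotent_commutator] applies; the removed part is a column
    unipotent of level J. The ideals A' and B' are abstract so as to cover both ab and ba. *)
Lemma unipotent_mul_mixed (A' B' : set R) k a b u v :
    two_sided_ideal A' -> two_sided_ideal B' ->
    (forall x y, elementary_subgroup n A' x -> elementary_subgroup n B' y ->
      H (commutator x y)) ->
    A' a -> B' b -> J (a * b) -> v *m u = 0 -> u k 0 = 0 ->
  H (unipotent (u *m ((a * b)%:M : 'M_1)) v).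
Proof.
move=> idA' idB' HAB Aa Bb Jab vu uk.
pose w := v - v 0 k *: 'row_k.
have ru c : 'row_k *m (u *m (c%:M : 'M_1)) = 0.
  by rewrite mulmxA row_mul uk raddf0 mul0mx.
have wu c : w *m (u *m (c%:M : 'M_1)) = 0.
  by rewrite mulmxBl mulmxA vu mul0mx -scalemxAl ru scaler0 subr0.
rewrite -[v](subrK (v 0 k *: 'row_k)) -/w unipotentDr //; last first.
  by rewrite -scalemxAl ru scaler0.
apply: (subgroupM sH).
  rewrite (@unipotent_prod _ _ _ _ (u *m (a%:M : 'M_1)) (b *: w)); last first.
    by rewrite scalar_mxM -!mulmxA (mul_scalar_mx b).
  have wk : w 0 k = 0 by rewrite !mxE !eqxx mulr1 subrr.
  rewrite (@unipotent_commutator _ _ k); last 3 first.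
  - by rewrite colZE uk mul0r.
  - by rewrite mxE wk mulr0.
  - by rewrite -scalemxAl wu scaler0.
  apply: HAB; [apply: elementary_col|apply: elementary_row].
  - by move=> i; rewrite colZE; apply: ideal_mull.
  - by rewrite colZE uk mul0r.
  - by move=> i; rewrite mxE; apply: ideal_mulr.
  - by rewrite mxE wk mulr0.
rewrite (@unipotent_prod _ _ _ _ (u *m ((a * b * v 0 k)%:M : 'M_1)) 'row_k); last first.
  by rewrite [in RHS]scalar_mxM -!mulmxA (mul_scalar_mx (v 0 k)).
apply: elementary_mixed; apply: elementary_col; last by rewrite colZE uk mul0r.
by move=> i; rewrite colZE; apply: (ideal_mull idJ); apply: (ideal_mulr idJ).
Qed.

(** Splitting u along the kernel of v provides a zero entry k, and additivity in the coefficient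
    reduces J to the products ab and ba. *)
Lemma relative_mixed : relative_elementary J `<=` H.
Proof.
apply: generated_sub => // _ [l _ [u [v [Ju vu vl ->]]]].
rewrite [u](annihilated_col_sum l vu).
have va q c : v *m (annihilated_col l v q *m (c%:M : 'M_1)) = 0.
  by rewrite mulmxA mul_annihilated_col // mul0mx.
apply: unipotent_sum => // q.
apply: (Ju q [set c | H (unipotent (annihilated_col l v q *m (c%:M : 'M_1)) v)]) => /=.
- by rewrite raddf0 mulmx0 unipotent0; apply: (subgroup1 sH).
- move=> x y Hx Hy; rewrite (_ : (x - y)%:M = x%:M - y%:M); last by rewrite raddfB.
  rewrite mulmxBr unipotentDl ?mulmxN ?va ?oppr0 // -(unipotentV (va q y)).
  by apply: (subgroupM sH) => //; apply: (subgroupV sH).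
move=> a b Aa Bb; have [k [kq kl]] := third_index q l.
have [Jab Jba] := mixed_ideal_mul Aa Bb.
have dk := annihilated_col_entry v kq kl.
have vd := mul_annihilated_col q vl.
by split; [apply: (unipotent_mul_mixed idA idB memH Aa Bb Jab vd dk)
          |apply: (unipotent_mul_mixed idB idA memH' Bb Aa Jba vd dk)].
Qed.

Hypothesis qfR : quasi_finite R.

Let sub_ER (I : set R) : elementary_subgroup n I `<=` ER.
Proof. exact: sub_elementary. Qed.

Lemma mixed_congr : H `<=` principal_congruence_subgroup n J.
Proof.
apply: generated_sub => [|_ [x /(elementary_congr idA) Ax [y /(elementary_congr idB) By <-]]].
  exact: congr_subgroup.
exact: commutator_congr_mixed.
Qed.

(** Since h lies in GL(n,R,J), the commutator [h,e] lies in K(J) and hence in H. *)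
Lemma mixed_normalized : normalizes ER H.
Proof.
move=> e h Ee Hh; have -> : (e * h * e^-1 = (commutator h e)^-1 * h)%g by group_simp.
apply: (subgroupM sH) => //; apply: (subgroupV sH); apply: relative_mixed.
by apply: (commutator_congr_elementary idJ) => //; apply: mixed_congr.
Qed.

(** With r = e_l - v, p = e + e_l r and w = u - e_l u_l, one has pw = u and e_l p^-1 = v. *)
Lemma root_set_conjugate (I : set R) l u v : two_sided_ideal I -> mx_in I u -> v *m u = 0 ->
    v 0 l = 1 ->
  exists (r : 'rV[R]_n) y, [/\ r 0 l = 0, elementary_subgroup n I y &
    unipotent u v = (unipotent 'col_l r * y * (unipotent 'col_l r)^-1)%g].
Proof.
move=> idI Iu vu vl; pose r := 'row_l - v.
have rl : r 0 l = 0 by rewrite !mxE !eqxx vl subrr.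
have rc : r *m 'col_l = 0 by rewrite mul_col rl raddf0.
pose w := u - 'col_l *m ((u l 0)%:M : 'M_1).
have wl : w l 0 = 0 by rewrite mxE [X in _ + X]mxE colZE mxE !eqxx mul1r subrr.
have lw : 'row_l *m w = 0 by rewrite row_mul wl raddf0.
exists r, (unipotent w 'row_l); split=> //.
  apply: elementary_col => // i; apply: mx_inD => //; apply: mx_inN => //.
  apply: mx_in_mull => // a b.
  by rewrite (ord1 a) (ord1 b) mxE eqxx; apply: Iu.
rewrite unipotentJ // unipotentV // !unipotentE ?mulmxN ?rc ?oppr0 //.
have rw : r *m w = (u l 0)%:M.
  by rewrite mulmxBl lw sub0r mulmxBr vu mulmxA mul_col vl mul1mx sub0r opprK.
apply: (congr2 (@unipotent n R)); apply: esym.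
  by rewrite mulmxDl mul1mx -mulmxA rw subrK.
rewrite mulmxDr mulmx1 mulNmx mulmxN mulmxA row_mul mxE !eqxx mul1mx.
by rewrite /r opprB addrC subrK.
Qed.

Lemma relative_elementary_sub (I : set R) : two_sided_ideal I ->
  relative_elementary I `<=` ER.
Proof.
move=> idI; apply: generated_sub => // _ [l _ [u [v [Iu vu vl ->]]]].
have [|r [y [rl Iy ->]]] := root_set_conjugate idI _ vu vl.
  by move=> a b; rewrite (ord1 b); apply: Iu.
have Er : ER (unipotent 'col_l r) by apply: elementary_row.
apply: (subgroupM (sE _)) => //; last exact: (subgroupV (sE _)).
by apply: (subgroupM (sE _)) => //; apply: sub_ER Iy.
Qed.

(** Generators of K(B) may be taken as p y p^-1 with y in E(n,B) and p a unipotent in a row k != j.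
    Then p^-1 t p is still a unipotent of level A in column j, so it lies in E(n,A). *)
Lemma transvection_relative i j a (ij : i != j) q : A a -> relative_elementary B q ->
  H (commutator (transvection a ij) q).
Proof.
move=> Aa Bq; have sP := commutator_preimage (transvection a ij) (sE _) sH mixed_normalized.
suff /(_ q Bq)[] : relative_elementary B `<=`
    [set q | ER q /\ H (commutator (transvection a ij) q)] by [].
apply: generated_sub => // h [l _ /(@root_set_other B idB l j)].
apply: generated_sub => // {h} h [k kj kh]; split.
  by apply: (relative_elementary_sub idB); apply: mem_generated; exists k.
case: kh => u [v [Bu vu vk ->]].
have [|r [y [rk By ->]]] := root_set_conjugate idB _ vu vk.
  by move=> c d; rewrite (ord1 d); apply: Bu.
set p := unipotent 'col_k r; set t := transvection a ij.
have Ep : ER p by apply: elementary_row.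
have -> : (commutator t (p * y * p^-1) = p * commutator (p^-1 * t * p^-1^-1) y * p^-1)%g.
  by group_simp.
apply: mixed_normalized => //; apply: memH => //.
have rc : r *m 'col_k = 0 by rewrite mul_col rk raddf0.
rewrite /t transvectionE unipotentJ; last first.
  by rewrite mulmxA row_col ?mul0mx // eq_sym.
have -> : 'row_j *m GL_mx p^-1^-1%g = 'row_j.
  by rewrite invgK unipotentE // mulmxDr mulmx1 mulmxA row_col ?mul0mx ?addr0 // eq_sym.
apply: elementary_col => [b|].
  rewrite mulmxA mxE; apply: ideal_sum => // c _.
  by rewrite (ord1 c) [in X in _ * X]mxE eqxx; apply: ideal_mull.
rewrite mulmxA colZE unipotentV // unipotentE ?mulmxN ?rc ?oppr0 //.
rewrite mulmxDl mul1mx !mulNmx -mulmxA mul_col mxE [X in X + _]mxE [X in _ + X]mxE colZE mxE.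
by rewrite [j == i]eq_sym (negPf ij) [j == k]eq_sym (negPf kj) mul0r subr0 mul0r.
Qed.

Lemma transvection_congr i j a (ij : i != j) g : A a ->
  principal_congruence_subgroup n B g -> H (commutator (transvection a ij) g).
Proof.
move=> Aa Bg; have [k [ki kj]] := third_index i j.
have ik : i != k by rewrite eq_sym.
set t := transvection a ij; pose x := transvection a ik; pose y := transvection (1 : R) kj.
have Et' : t = commutator x y by rewrite /x /y -(transvection_commutator a 1 ik kj ij) mulr1.
have Ax : EA x by apply: Et.
have Ey : ER y by apply: Et.
have Ex : ER x by apply: sub_ER Ax.
pose p := commutator g x; pose q := commutator g y.
have Jp : principal_congruence_subgroup n J p.
  rewrite /p -commutatorV; apply: (subgroupV (congr_subgroup idJ)).
  by apply: commutator_congr_mixed => //; apply: elementary_congr.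
have Kq : relative_elementary B q by apply: commutator_congr_elementary.
have Eq : ER q by apply: (relative_elementary_sub idB).
pose z := (x * (q * y) * x^-1)%g.
have Ez : ER z.
  by do !apply: (subgroupM (sE _)) => //; apply: (subgroupV (sE _)).
rewrite -commutatorV; apply: (subgroupV sH).
(* This expands g t g^-1 = [px, qy]. *)
have -> : commutator g t = (commutator p z * commutator x q * commutator q t)%g.
  by rewrite Et' /z /p /q; group_simp.
apply: (subgroupM sH); last first.
  by rewrite -commutatorV; apply: (subgroupV sH); apply: transvection_relative.
apply: (subgroupM sH); last exact: transvection_relative.
by apply: relative_mixed; apply: (commutator_congr_elementary idJ).
Qed.

(** As E(n,R) normalizes H, [commutator_preimage] reduces one inclusion to transvections; the other
    holds because E(n,B) lies in GL(n,R,B). *)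
Lemma elementary_congr_commutator :
  commutator_subgroup EA (principal_congruence_subgroup n B) = H.
Proof.
apply/seteqP; split; last first.
  apply: generated_sub => [|_ [x Ax [y By <-]]]; first exact: generated_subgroup.
  by apply: mem_generated; exists x => //; exists y => //; apply: elementary_congr.
apply: generated_sub => // _ [x Ax [g Bg <-]].
have sP := commutator_preimage g (sE _) sH mixed_normalized.
rewrite -commutatorV; apply: (subgroupV sH); apply: (proj2 (generated_sub sP _ Ax)).
move=> _ [i [j [ij [a [Aa ->]]]]]; split; first exact: Et.
by rewrite -commutatorV; apply: (subgroupV sH); apply: transvection_congr.
Qed.

End MixedCommutators.
End Elementary.

Theorem theorem3 (R : pzRingType) (n : nat) (A B : set R) :
  quasi_finite R -> (3 <= n)%N ->
  two_sided_ideal A -> two_sided_ideal B ->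
  commutator_subgroup (elementary_subgroup n A)
                      (principal_congruence_subgroup n B) =
  commutator_subgroup (elementary_subgroup n A) (elementary_subgroup n B).
Proof. by move=> qfR n3 idA idB; apply: elementary_congr_commutator. Qed.
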